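(* Let $\mathbf G\sim\mathcal G(\mathbf n,P)$, where $P=(p_{ij})_{i,j\in[k]}$ satisfies $p_{ij}=p_{ji}$ and $0\le p_{ij}<1$ for all $i,j\in[k]$. Let $\sigma\in[0,\sigma_0]$ for some fixed $0<\sigma_0<\tfrac14$. Assume that $$\|\mathbf n\|\to\infty,\quad k=\|\mathbf n\|^{o(1)},\quad q^*=\|\mathbf n\|^{-\sigma+o(1)},\quad\hat q(\mathbf n)=\|\mathbf n\|^{-\sigma+o(1)},\quad w_*(\mathbf n,Q)\gg k\,\hat q(\mathbf n)\,q^*\frac{\|\mathbf n\|}{\log\|\mathbf n\|}.$$ Then, for any fixed $\epsilon>0$, $$\Pr\Big(\chi(\mathbf G)>(1+\epsilon)\frac{w_*(\mathbf n,Q)}{2\log(q^*\|\mathbf n\|)}\Big)\le\exp\big(-\|\mathbf n\|^{2-4\sigma+o(1)}\big).$$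
   Context: Stochastic block model $\mathcal G(\mathbf n,P)$: for $\mathbf n=(n_1,\dots,n_k)^T$ with positive integer entries and a symmetric $k\times k$ matrix $P$ with entries in $[0,1)$, the random graph has vertex set partitioned into blocks $B_1,\dots,B_k$, $|B_i|=n_i$, and distinct $u\in B_i,v\in B_j$ are adjacent independently with probability $p_{ij}$. $Q=(q_{ij})$, $q_{ij}=\log\frac1{1-p_{ij}}$; $q^*=\max_iq_{ii}$; $\hat q(\mathbf x)=\sum_ix_iq_{ii}/\|\mathbf x\|$ for $\mathbf x\ne\mathbf 0$. $\|\mathbf x\|$ is the 1-norm; $\mathbf y\preceq\mathbf x$ means $\mathbf x-\mathbf y\in[0,\infty)^k$; $w(\mathbf x,Q)=\max_{\mathbf 0\preceq\mathbf y\preceq\mathbf x}\frac{\mathbf y^TQ\mathbf y}{\|\mathbf y\|}$ (ratio $0$ at $\mathbf y=\mathbf 0$); $w_*(\mathbf x,Q)=\inf\sum_{\mathbf y\in\mathcal S}w(\mathbf y,Q)$ over finite systems $\mathcal S$ of vectors in $[0,\infty)^k$ summing to $\mathbf x$. All quantities depend on an index $n\to\infty$; asymptotic notation refers to $n\to\infty$ uniformly over sequences satisfying the hypotheses; $a\gg b$ means $b=o(a)$; the $o(1)$ in the exponent is a function of $n$ only. *)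

(* Defs.v *)
From HB Require Import structures.
From mathcomp Require Import all_boot all_order all_algebra.
From mathcomp Require Import all_classical all_reals all_analysis.

Set Implicit Arguments.
Unset Strict Implicit.
Unset Printing Implicit Defensive.

Import Order.TTheory GRing.Theory Num.Theory.
Import numFieldNormedType.Exports.

Local Open Scope ring_scope.
Local Open Scope classical_set_scope.

Section Graphs.
Variable V : finType.

Definition simple_edges (E : {set V * V}) : bool :=
  [forall u, (u, u) \notin E] &&
  [forall u, forall v, ((u, v) \in E) == ((v, u) \in E)].

Record sgraph := SGraph { edges : {set V * V}; _ : simple_edges edges }.

HB.instance Definition _ := [isSub for edges].
HB.instance Definition _ := [Finite of sgraph by <:].

Definition adj (G : sgraph) (u v : V) : bool := (u, v) \in edges G.

Lemma adj_irr (G : sgraph) u : adj G u u = false.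
Proof.
by case: G => E sE; have /andP[/forallP/(_ u)/negPf uuE _] := sE.
Qed.

Lemma adj_sym (G : sgraph) u v : adj G u v = adj G v u.
Proof.
by case: G => E sE; have /andP[_ /forallP/(_ u)/forallP/(_ v)/eqP] := sE.
Qed.

Definition colorable (G : sgraph) (c : nat) : bool :=
  [exists f : {ffun V -> 'I_c},
     [forall u, forall v, adj G u v ==> (f u != f v)]].

Lemma ex_colorable (G : sgraph) : exists c, colorable G c.
Proof.
exists #|V|; apply/existsP; exists [ffun u => enum_rank u].
apply/forallP => u; apply/forallP => v; apply/implyP => uv.
rewrite !ffunE; apply: contraTneq uv => /enum_rank_inj ->.
by rewrite adj_irr.
Qed.

Definition chromatic_number (G : sgraph) : nat := ex_minn (ex_colorable G).

End Graphs.

Section BlockModel.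
Variables (R : realType) (k : nat) (n : 'I_k -> nat) (P : 'M[R]_k).

(* the vertex [Tagged _ a] with [a : 'I_(n i)] is the [a]-th vertex of B_i *)
Definition sbm_vertex : finType := {i : 'I_k & 'I_(n i)}.

(* The order [enum_rank u < enum_rank v] enumerates each unordered pair of
   distinct vertices exactly once. *)
Definition sbm_weight (G : sgraph sbm_vertex) : R :=
  \prod_(e : sbm_vertex * sbm_vertex | (enum_rank e.1 < enum_rank e.2)%N)
    (if adj G e.1 e.2 then P (tag e.1) (tag e.2)
     else 1 - P (tag e.1) (tag e.2)).

Definition sbm_Pr (A : pred (sgraph sbm_vertex)) : R :=
  \sum_(G | A G) sbm_weight G.

Lemma sbm_Pr_total : sbm_Pr predT = 1.
Proof.
pose I := [pred e : sbm_vertex * sbm_vertex | (enum_rank e.1 < enum_rank e.2)%N].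
pose T := {e in I}.
have H : \prod_(e : T) (P (tag (val e).1) (tag (val e).2) +
             (1 - P (tag (val e).1) (tag (val e).2))) = 1 :> R.
  by rewrite big1 // => e _; rewrite addrC subrK.
rewrite -[RHS]H bigA_distr /sbm_Pr /sbm_weight.
pose mk (J : {set T}) : {set sbm_vertex * sbm_vertex} :=
  finset (fun e => (e \in val @: J)%SET || ((e.2, e.1) \in val @: J)%SET).
have lt_mk (J : {set T}) e : (e \in val @: J)%SET -> (enum_rank e.1 < enum_rank e.2)%N.
  by move=> /imsetP[[x /= xI] _ ->].
have mkS (J : {set T}) : simple_edges (mk J).
  apply/andP; split; apply/forallP => u.
    by rewrite inE /= orbb; apply/negP => /lt_mk; rewrite ltnn.
  by apply/forallP => v; rewrite !inE /= orbC.
rewrite (reindex_onto (fun J : {set T} => SGraph (mkS J))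
  (fun G : sgraph _ => finset (fun e : T => val e \in edges G))); last first.
  move=> G _; apply: val_inj => /=; apply/setP => -[u v]; rewrite inE /=.
  have mem a b : ((a, b) \in val @: finset (fun e : T => val e \in edges G))%SET =
      adj G a b && (enum_rank a < enum_rank b)%N.
    apply/imsetP/andP => [[[x xI]] /=|[ab lab]].
      by rewrite inE /= => xG abE; rewrite /adj abE; split=> //; move: xI; rewrite -abE.
    have abI : (a, b) \in I by [].
    by exists (Sub (a, b) abI); rewrite ?inE.
  rewrite !mem (adj_sym G v u) -andb_orr -/(adj G u v).
  have [<-|uv] := eqVneq u v; first by rewrite adj_irr.
  by rewrite -neq_ltn (inj_eq val_inj) (inj_eq enum_rank_inj) uv andbT.
apply: eq_big => [J|J _].
  apply/eqP/setP => e; rewrite !inE /= (mem_imset _ _ val_inj).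
  case: (boolP (_ \in val @: J)%SET) => [/lt_mk /= h|]; last by rewrite orbF.
  by have := valP e; rewrite inE ltnNge ltnW.
rewrite (big_sub I) /=; apply: eq_bigr => e _.
have -> // : adj (SGraph (mkS J)) (val e).1 (val e).2 = (e \in J).
rewrite /adj /= inE -surjective_pairing (mem_imset _ _ val_inj) /=.
case: (boolP (_ \in val @: J)%SET) => [/lt_mk /= h|]; last by rewrite orbF.
by have := valP e; rewrite inE ltnNge ltnW.
Qed.

End BlockModel.

Section Weights.
Variables (R : realType) (k : nat).
Implicit Types (x y : 'cV[R]_k) (P Q : 'M[R]_k).

Definition logQ P : 'M[R]_k := \matrix_(i, j) ln (1 / (1 - P i j)).

Definition norm1 x : R := \sum_i `|x i 0|.

(* The q_ii are nonnegative, so the default 0 of the iterated maximum is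
   harmless. *)
Definition qstar Q : R := \big[Order.max/0]_i Q i i.

Definition qhat x Q : R := (\sum_i x i 0 * Q i i) / norm1 x.

(* At y = 0 the quotient is 0, because 0^-1 = 0. *)
Definition wratio y Q : R := (y^T *m Q *m y) 0 0 / norm1 y.

(* For x in [0, oo)^k the supremum is attained: the quotient is continuous on
   the compact box, including at y = 0. *)
Definition w x Q : R :=
  sup [set wratio y Q |
         y in [set y : 'cV[R]_k | forall i, 0 <= y i 0 <= x i 0]].

Definition vec_system x : set (seq 'cV[R]_k) :=
  [set S | (forall y : 'cV[R]_k, y \in S -> forall i, 0 <= y i 0) /\ \sum_(y <- S) y = x].

Definition wstar x Q : R :=
  inf [set \sum_(y <- S) w y Q | S in vec_system x].

Definition size_vec (n : 'I_k -> nat) : 'cV[R]_k := \col_i (n i)%:R.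

End Weights.

(* x = N^(s + o(1)), where r bounds the absolute value of the o(1) *)
Definition pow_within (R : realType) (x N s r : R) : Prop :=
  exists2 d : R, `|d| <= r & x = N `^ (s + d).

(* Main.v *)
(** The colouring is built greedily. By Caratheodory's theorem, a nearly optimal system for
    w_* may be taken with at most k vectors y. With lam slightly below ln (q* |n|), every
    l <= (2 lam / w(y)) y satisfies l^T Q l <= 2 lam |l|, so the expected number of
    independent sets with profile about (2 lam / w(y)) y is large in every vertex set that
    retains a fraction |n|^(-o(1)) of each block. Janson's inequality shows that such a vertex
    set contains no set with this profile with probability at most exp(- |n|^(2 - 4 sigma - o(1))),
    which beats the 2^|n| choices of the vertex set because sigma < 1/4. Removing about
    w(y) / (2 lam) sets for each y leaves few vertices in each block, and they are coloured
    block by block with smaller independent sets.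

    Janson's inequality needs the pairs of vertices in a profile to have small energy, which
    fails if a block contributes only a few vertices; such blocks are dropped from the profile,
    and k q* = o(ln |n|), a consequence of the hypothesis on w_*, bounds the cost of this. *)

Require Import Defs.
From mathcomp Require Import all_boot all_order all_algebra.
From mathcomp Require Import reals sequences exp.
From mathcomp Require Import lra.

Set Implicit Arguments.
Unset Strict Implicit.
Unset Printing Implicit Defensive.

Import Order.TTheory GRing.Theory Num.Theory.
Local Open Scope ring_scope.

(** * Product measures and Janson's inequality *)

(** The exponent 2 - 4 sigma comes from pairs of sets sharing two vertices. A profile has at most
    N^(sigma + o(1)) vertices, each drawn from its own m = N^(1 - sigma - o(1)) candidates, so such
    pairs contribute N^(- 2 + 4 sigma + o(1)) to the normalised correlation sum, whose reciprocal
    governs Janson's inequality. Larger intersections must not contribute more. One of s vertices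
    has energy at most lam s, and e^lam is below m by a power of N; this suffices unless s is so
    small that the number of subsets of size s matters, and there the energy has to be at most rho
    lam s with a small rho. Hence the lower bounds on the coordinates of a profile.

    Coordinates dropped for being below the threshold K leave up to K C vertices in a block, where C
    colours are spent on the pieces and K is constant. With sets of order ln N / q* they cost about
    k q* K C / ln N colours in all, which is o(C): as w_* <= qhat N, the hypothesis on w_* gives k
    q* = o(ln N).

    All this is done with a fixed loss h in the exponents; a diagonal choice of h tending to 0 gives
    the o(1). *)

Lemma finset_ind (T : finType) (P : {set T} -> Prop) :
  P set0 -> (forall (e : T) (D : {set T}), e \notin D -> P D -> P (e |: D)) ->
  forall D, P D.
Proof.
move=> P0 PU D; move En : #|D| => n; elim: n D En => [|n IHn] D En.
  by move/eqP: En; rewrite cards_eq0 => /eqP ->.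
have /card_gt0P[e eD] : (0 < #|D|)%N by rewrite En.
rewrite -(setD1K eD); apply: PU; first by rewrite !inE eqxx.
by apply: IHn; move: En; rewrite (cardsD1 e) eD => -[].
Qed.

Section ProductMeasure.
Variables (R : realType) (T : finType) (p : T -> R).
Hypothesis p01 : forall e, 0 <= p e <= 1.
Implicit Types (D B C J : {set T}) (f g h : {set T} -> R).

(* The expectation of [h J] when [J] contains each [e] in [D] independently
   with probability [p e], and no other element. *)
Definition bexp D h : R :=
  \sum_(J : {set T} | J \subset D)
    (\prod_(e in D) (if e \in J then p e else 1 - p e)) * h J.

Definition avoids B J : bool := [disjoint B & J].

Definition pavoid B : R := \prod_(e in B) (1 - p e).

Lemma bexp0 h : bexp set0 h = h set0.
Proof.
rewrite /bexp (big_pred1 set0) => [|J]; last by rewrite subset0.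
by rewrite big1 ?mul1r // => e; rewrite inE.
Qed.

(** Conditioning on whether [e] is drawn; the inductions on [D] below all go through this
    identity. *)
Lemma bexpU1 e D h : e \notin D ->
  bexp (e |: D) h = bexp D (fun J => p e * h (e |: J) + (1 - p e) * h J).
Proof.
move=> eD; rewrite /bexp (bigID (fun J : {set T} => e \in J)) /=.
have notin J : J \subset D -> e \notin J.
  by move=> /subsetP JD; apply: contra eD; apply: JD.
under [RHS]eq_bigr => J _ do rewrite mulrDr.
rewrite big_split /=; congr (_ + _).
- rewrite (reindex_onto (fun J => e |: J) (fun J => J :\ e)) /=; last first.
    by move=> J /andP[_ eJ]; rewrite setD1K.
  apply: eq_big => [J|J].
    apply/idP/idP => [/andP[/andP[sub _] /eqP <-]|JD].
      by rewrite subDset.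
    by rewrite setUS // setU11 setU1K ?eqxx ?notin.
  move=> /andP[/andP[sub _] /eqP eqJ].
  rewrite big_setU1 //= setU11 mulrCA mulrA; congr (_ * _ * _).
  apply: eq_bigr => e' e'D; rewrite in_setU1; case: eqP => // ee'.
  by rewrite -ee' e'D in eD.
- apply: eq_big => [J|J].
    apply/idP/idP => [/andP[/subsetP sub eJ]|JD].
      apply/subsetP => x xJ; have := sub x xJ; rewrite in_setU1; case/orP=> // /eqP xe.
      by rewrite -xe xJ in eJ.
    by rewrite notin // andbT (subset_trans JD) // subsetUr.
  by move=> /andP[_ eJ]; rewrite big_setU1 //= (negPf eJ) mulrCA mulrA.
Qed.

Lemma eq_bexp D f g : f =1 g -> bexp D f = bexp D g.
Proof. by move=> fg; apply: eq_bigr => J _; rewrite fg. Qed.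

Lemma bexp_weight_ge0 D J :
  0 <= \prod_(e in D) (if e \in J then p e else 1 - p e).
Proof.
by apply: prodr_ge0 => e _; have /andP[? ?] := p01 e; case: ifP => _; lra.
Qed.

Lemma le_bexp D f g : (forall J, f J <= g J) -> bexp D f <= bexp D g.
Proof.
by move=> fg; apply: ler_sum => J _; apply: ler_wpM2l => //; apply: bexp_weight_ge0.
Qed.

Lemma bexp_ge0 D f : (forall J, 0 <= f J) -> 0 <= bexp D f.
Proof.
by move=> f0; apply: sumr_ge0 => J _; apply: mulr_ge0 => //; apply: bexp_weight_ge0.
Qed.

Lemma bexpD D f g : bexp D (fun J => f J + g J) = bexp D f + bexp D g.
Proof. by rewrite -big_split; apply: eq_bigr => J _; rewrite mulrDr. Qed.

Lemma bexpZ D c f : bexp D (fun J => c * f J) = c * bexp D f.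
Proof. by rewrite mulr_sumr; apply: eq_bigr => J _; rewrite mulrCA. Qed.

Lemma bexpB D f g : bexp D (fun J => f J - g J) = bexp D f - bexp D g.
Proof.
rewrite -[- bexp D g]mulN1r -bexpZ -bexpD; apply: eq_bexp => J.
by rewrite mulN1r.
Qed.

Lemma bexp_sum I (s : seq I) (P : pred I) D (F : I -> {set T} -> R) :
  bexp D (fun J => \sum_(i <- s | P i) F i J) = \sum_(i <- s | P i) bexp D (F i).
Proof.
by rewrite exchange_big /=; apply: eq_bigr => J _; rewrite mulr_sumr.
Qed.

Lemma bexp1 D : bexp D (fun=> 1) = 1.
Proof.
elim/finset_ind: D => [|e D eD IH]; first by rewrite bexp0.
by rewrite bexpU1 // -[RHS]IH; apply: eq_bexp => J; rewrite !mulr1 addrC subrK.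
Qed.

(** Induction on [D]: conditioning on one element reduces the claim to a two-point space, where the
    gap is [p (1 - p) (b - a) (d - c)], nonnegative by monotonicity. *)
Lemma harris D f g :
  (forall e J, f (e |: J) <= f J) -> (forall e J, g J <= g (e |: J)) ->
  bexp D (fun J => f J * g J) <= bexp D f * bexp D g.
Proof.
elim/finset_ind: D f g => [|e D eD IH] f g df ig; first by rewrite !bexp0.
rewrite !bexpU1 //.
apply: (@le_trans _ _ (bexp D (fun J =>
  (p e * f (e |: J) + (1 - p e) * f J) * (p e * g (e |: J) + (1 - p e) * g J)))).
  apply: le_bexp => J; have /andP[p0 p1] := p01 e.
  have := df e J; have := ig e J; set a := f _; set b := f _; set c := g _; set d := g _.
  move=> cd ab; rewrite -subr_ge0.
  have -> : (p e * a + (1 - p e) * b) * (p e * d + (1 - p e) * c) -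
      (p e * (a * d) + (1 - p e) * (b * c)) = p e * (1 - p e) * ((b - a) * (d - c)).
    by lra.
  by rewrite !mulr_ge0 ?subr_ge0.
by apply: IH => e' J; rewrite (setUCA [set e]) lerD // ler_wpM2l //;
  have /andP[? ?] := p01 e; lra.
Qed.

Lemma avoidsU1 B e J : avoids B (e |: J) = (e \notin B) && avoids B J.
Proof.
rewrite /avoids -!setI_eq0 setIUr setU_eq0; congr (_ && _).
by rewrite setI_eq0 disjoint_sym disjoints1.
Qed.

Lemma bexp_avoidsM D B h : B \subset D ->
  (forall e J, e \in B -> h (e |: J) = h J) ->
  bexp D (fun J => (avoids B J)%:R * h J) = pavoid B * bexp D h.
Proof.
(* In the product [B] becomes [B :&: D], so that the induction on [D] does not have to maintain
   [B \subset D]. *)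
move=> /setIidPl BD hB; rewrite -{2}BD /pavoid {BD}.
elim/finset_ind: D h hB => [|e D eD IH] h hB.
  rewrite !bexp0 setI0 big_set0 mul1r /avoids -setI_eq0 setI0 eqxx mul1r //.
rewrite !bexpU1 //; have [eB|eB] := boolP (e \in B).
  have -> : B :&: (e |: D) = e |: (B :&: D).
    by apply/setP => x; rewrite !inE; case: eqP => // ->; rewrite eB.
  rewrite big_setU1 ?inE ?(negPf eD) ?andbF //= -mulrA.
  under eq_bexp => J do rewrite avoidsU1 eB mul0r mulr0 add0r.
  rewrite bexpZ IH //; congr (_ * (_ * _)); apply: eq_bexp => J.
  by rewrite hB //; lra.
have -> : B :&: (e |: D) = B :&: D.
  by apply/setP => x; rewrite !inE; case: eqP => // ->; rewrite (negPf eB).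
rewrite -IH => [|e' J e'B]; last by rewrite (setUCA [set e]) !(hB e').
by apply: eq_bexp => J; rewrite avoidsU1 eB /=; lra.
Qed.

Lemma bexp_avoids D B : B \subset D ->
  bexp D (fun J => (avoids B J)%:R) = pavoid B.
Proof.
move=> BD; have := @bexp_avoidsM D B (fun=> 1) BD (fun _ _ _ => erefl).
by rewrite bexp1 mulr1 => <-; apply: eq_bexp => J; rewrite mulr1.
Qed.

Lemma avoidsU B C J : avoids (B :|: C) J = avoids B J && avoids C J.
Proof. by rewrite /avoids -!setI_eq0 setIUl setU_eq0. Qed.

Definition hits_all (s : seq {set T}) J : bool := all (fun B => ~~ avoids B J) s.

Lemma hits_allU1 s e J : hits_all s J -> hits_all s (e |: J).
Proof.
move=> /allP hs; apply/allP => B /hs; rewrite avoidsU1.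
by apply: contra => /andP[].
Qed.

(** Janson's mu - Delta / 2, with each interacting pair charged once, to its earlier member. The
    list may repeat a set, and a nonempty repeated set interacts with itself. *)
Fixpoint janson_exponent (s : seq {set T}) : R :=
  if s is B :: s' then
    pavoid B - \sum_(C <- s' | ~~ [disjoint B & C]) pavoid (B :|: C)
      + janson_exponent s'
  else 0.

Lemma pavoid_ge0 B : 0 <= pavoid B.
Proof. by apply: prodr_ge0 => e _; have /andP[? ?] := p01 e; lra. Qed.

(* Boppana and Spencer's proof: the sets of [s] disjoint from [B] are hit
   independently of [B], and Harris' inequality controls the other ones. *)
Lemma janson D (s : seq {set T}) : all (fun B => B \subset D) s ->
  bexp D (fun J => (hits_all s J)%:R) <= expR (- janson_exponent s).
Proof.
elim: s => [|B s IH] /=.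
  by rewrite oppr0 expR0; under eq_bexp => J do rewrite /hits_all /=; rewrite bexp1.
move=> /andP[BD sD]; have {}IH := IH sD.
set b := pavoid B - _.
set Z := bexp D (fun J => (hits_all s J)%:R) in IH *.
pose s1 := [seq C : {set T} <- s | [disjoint B & C]].
pose N J := hits_all s1 J.
have NE : bexp D (fun J => (avoids B J)%:R * (N J)%:R) = pavoid B * bexp D (fun J => (N J)%:R).
  apply: bexp_avoidsM => // e J eB; congr (_%:R); congr (nat_of_bool _).
  apply: eq_in_all => C; rewrite mem_filter => /andP[BC _]; rewrite avoidsU1.
  suff -> : e \notin C by [].
  by rewrite (disjointFr BC).
have Z0 : 0 <= Z by apply: bexp_ge0 => J; rewrite ler0n.
have ZN : Z <= bexp D (fun J => (N J)%:R).
  apply: le_bexp => J; rewrite ler_nat.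
  case: (boolP (hits_all s J)) => // /allP hs; rewrite /N.
  suff -> : hits_all s1 J by [].
  by apply/allP => C; rewrite mem_filter => /andP[_ /hs].
have key : Z * b <= bexp D (fun J => (avoids B J)%:R * (hits_all s J)%:R).
  have [b0|/ltW b0] := leP 0 b; last first.
    apply: (@le_trans _ _ 0); first by rewrite mulr_ge0_le0.
    by apply: bexp_ge0 => J; rewrite mulr_ge0.
  apply: (@le_trans _ _ (bexp D (fun J => (N J)%:R) * b)); first exact: ler_wpM2r.
  (* If [B] is avoided and [N] holds, but some set of [s] is not hit, then that set interacts with
     [B] and is avoided as well: a union bound over the interacting sets. *)
  apply: (@le_trans _ _ (bexp D (fun J => (avoids B J)%:R * (N J)%:R -
     \sum_(C <- s | ~~ [disjoint B & C]) (avoids (B :|: C) J)%:R * (N J)%:R))); last first.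
    apply: le_bexp => J; case aB: (avoids B J); last first.
      by rewrite !mul0r big1 ?subr0 // => C _; rewrite avoidsU aB mul0r.
    rewrite !mul1r; case hs: (hits_all s J).
      rewrite lerBlDr ler_wpDr //; last by case: (N J).
      by apply: sumr_ge0 => C _; rewrite mulr_ge0.
    rewrite subr_le0; case nJ: (N J); last first.
      by apply: sumr_ge0 => C _; rewrite mulr_ge0.
    have /allPn[C Cs aC] := negbT hs; rewrite negbK in aC.
    have dC : ~~ [disjoint B & C].
      apply/negP => dC; have /allP /(_ C) := nJ.
      by rewrite mem_filter dC Cs aC => /(_ isT).
    rewrite (big_rem C) //= dC avoidsU aB aC mulr1.
    by rewrite lerDl; apply: sumr_ge0 => C' _; rewrite mulr_ge0.
  rewrite bexpB NE bexp_sum mulrC mulrBl lerD2l lerN2 mulr_suml.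
  rewrite big_seq_cond [leRHS]big_seq_cond; apply: ler_sum => C /andP[Cs _].
  apply: le_trans (harris _ _ _) _ => [e J|e J|].
  - by rewrite avoidsU1; case: (e \notin _).
  - rewrite ler_nat; case NJ: (N J) => //.
    by rewrite /N hits_allU1.
  - by rewrite bexp_avoids // subUset BD; apply: (allP sD).
have -> : bexp D (fun J => (hits_all (B :: s) J)%:R) =
    Z - bexp D (fun J => (avoids B J)%:R * (hits_all s J)%:R).
  rewrite -bexpB; apply: eq_bexp => J; rewrite /hits_all /= -/(hits_all s J).
  by case: (avoids B J); rewrite ?mul1r ?mul0r /= ?subrr ?subr0.
apply: (@le_trans _ _ (Z * (1 - b))); first by rewrite mulrBr mulr1; lra.
apply: (@le_trans _ _ (Z * expR (- b))); last first.
  by rewrite (opprD b) (expRD (- b)) [leLHS]mulrC ler_wpM2l ?expR_ge0.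
by apply: ler_wpM2l => //; exact: expR_ge1Dx.
Qed.

Lemma exists_le_average (F : finType) (x : F -> R) (c : R) :
  (0 < #|F|)%N -> \sum_(f : F) x f <= #|F|%:R * c -> exists f : F, x f <= c.
Proof.
move=> F0 sx; apply/existsP; apply: contraT; rewrite negb_exists => /forallP all_gt.
suff : \sum_(f : F) c < \sum_(f : F) x f.
  by rewrite sumr_const -[c *+ _]mulr_natl ltNge sx.
have /card_gt0P[f0 _] := F0.
rewrite (bigD1 f0) //= [ltRHS](bigD1 f0) //=.
apply: ltr_leD; first by have := all_gt f0; rewrite -ltNge.
by apply: ler_sum => f _; have := all_gt f; rewrite -ltNge => /ltW.
Qed.

(* The sequence is built greedily, each new set being chosen to interact with
   the previous ones no more than average. *)
Lemma exists_janson_sequence (F : finType) (B : F -> {set T}) (q d : R) (a : nat) :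
  (0 < #|F|)%N -> (forall f : F, pavoid (B f) = q) ->
  (forall f : F, \sum_(f' : F | ~~ [disjoint B f' & B f]) pavoid (B f' :|: B f)
     <= #|F|%:R * d) ->
  exists2 s : seq F, size s = a &
    a%:R * q - a%:R ^+ 2 / 2 * d <= janson_exponent (map B s).
Proof.
move=> F0 Bq Bd; elim: a => [|a [s sa IH]]; first by exists [::] => //=; lra.
have d0 : 0 <= d.
  have /card_gt0P[f0 _] := F0; have := Bd f0.
  have : 0 <= \sum_(f' | ~~ [disjoint B f' & B f0]) pavoid (B f' :|: B f0).
    by apply: sumr_ge0 => f _; apply: pavoid_ge0.
  move=> h1 h2; have := le_trans h1 h2; rewrite pmulr_rge0 // ltr0n //.
pose x (f : F) := \sum_(C <- map B s | ~~ [disjoint B f & C]) pavoid (B f :|: C).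
have [f xf] : exists f : F, x f <= a%:R * d.
  apply: exists_le_average => //; rewrite /x.
  under eq_bigr => f _ do rewrite big_map big_mkcond /=.
  rewrite exchange_big /= mulrCA -sa -sum1_size natr_sum mulr_suml.
  by apply: ler_sum => f' _; rewrite mul1r -big_mkcond.
exists (f :: s); first by rewrite /= sa.
rewrite /= Bq -/(x f) -natr1; set A := a%:R in IH xf *.
by have := IH; nra.
Qed.

(** A sequence of length a has exponent a q - (a q)^2 d / 2, which is largest, namely 1 / (2 d), at
    a = 1 / (q d). Rounding a down costs at most q <= 1 in a q, whence the summand 1 in the
    bound. *)
Lemma janson_family (F : finType) (B : F -> {set T}) (q d : R) D :
  (0 < #|F|)%N -> 0 < q -> q <= 1 -> 0 < d ->
  (forall f : F, B f \subset D) ->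
  (forall f : F, pavoid (B f) = q) ->
  (forall f : F, \sum_(f' : F | ~~ [disjoint B f' & B f]) pavoid (B f' :|: B f)
     <= #|F|%:R * (q ^+ 2 * d)) ->
  bexp D (fun J => [forall f : F, ~~ avoids (B f) J]%:R) <= expR (1 - (2 * d)^-1).
Proof.
move=> F0 q0 q1 d0 BD Bq Bd.
have qd0 : 0 < (q * d)^-1 by rewrite invr_gt0 mulr_gt0.
pose a := Num.truncn (q * d)^-1.
have /andP[ale alt] : a%:R <= (q * d)^-1 < a.+1%:R by apply: truncn_itv; apply: ltW.
have [s sa js] := exists_janson_sequence a F0 Bq Bd.
apply: (@le_trans _ _ (bexp D (fun J => (hits_all (map B s) J)%:R))).
  apply: le_bexp => J; rewrite ler_nat; case: forallP => // hf.
  suff -> : hits_all (map B s) J by [].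
  by apply/allP => C /mapP[f _ ->].
apply: le_trans (janson _) _.
  by apply/allP => C /mapP[f _ ->].
rewrite ler_expR lerNl; apply: le_trans js.
have aq1 : a%:R * q <= d^-1.
  move: ale; rewrite invfM -(ler_pM2r q0) => /le_trans; apply.
  by rewrite mulrAC mulVf ?mul1r // gt_eqF.
have aq2 : d^-1 - 1 <= a%:R * q.
  move: alt; rewrite invfM -(ltr_pM2r q0) mulrAC mulVf ?mul1r ?gt_eqF // -natr1; nra.
rewrite invfM; set e := d^-1 in aq1 aq2 *.
have de : d * e = 1 by rewrite mulfV // gt_eqF.
have e0 : 0 < e by rewrite invr_gt0.
set X := a%:R * q in aq1 aq2 *.
have X0 : 0 <= X by rewrite mulr_ge0 // ltW.
have -> : a%:R ^+ 2 / 2 * (q ^+ 2 * d) = 2^-1 * (X * (X * d)) by rewrite /X; lra.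
have : X * d <= 1 by rewrite -de mulrC ler_pM2l.
move=> Xd; have : X * (X * d) <= e by rewrite -[e]mulr1 ler_pM // mulr_ge0 // ltW.
lra.
Qed.

End ProductMeasure.

(** * Random graphs as random sets of pairs *)

Section OffDiagonal.
Variables (V : finType) (R : realType).

Definition rank_lt (e : V * V) : bool := (enum_rank e.1 < enum_rank e.2)%N.

Lemma rank_lt_total (u v : V) : u != v -> rank_lt (u, v) = ~~ rank_lt (v, u).
Proof.
move=> uv; rewrite /rank_lt /= -leqNgt [RHS]leq_eqVlt (inj_eq val_inj).
by rewrite (inj_eq enum_rank_inj) (negPf uv).
Qed.

Lemma rank_lt_neq (e : V * V) : rank_lt e -> e.1 != e.2.
Proof. by apply: contraTneq => eE; rewrite /rank_lt eE ltnn. Qed.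

Lemma sum_rank_lt (S : {set V}) (q : V -> V -> R) :
  (forall u v, q u v = q v u) ->
  \sum_(e : V * V | [&& rank_lt e, e.1 \in S & e.2 \in S]) q e.1 e.2 =
  2^-1 * \sum_(u in S) \sum_(v in S | v != u) q u v.
Proof.
move=> qC; set X := LHS.
suff -> : \sum_(u in S) \sum_(v in S | v != u) q u v = X + X by lra.
rewrite pair_big_dep /= (bigID rank_lt) /=; congr (_ + _).
  apply: eq_bigl => -[u v] /=; rewrite andbC.
  by case: (boolP (rank_lt _)) => //= /rank_lt_neq /=; rewrite eq_sym => ->; rewrite andbT.
rewrite /X (reindex_inj (h := fun e : V * V => (e.2, e.1))) /=; last first.
  by move=> [a b] [c d] /= [-> ->].
apply: eq_big => [[u v]|[u v] _] //=.
have [->|vu] := eqVneq v u; last first.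
  by rewrite (rank_lt_total vu) negbK; case: (u \in S); case: (v \in S); rewrite /= ?andbT ?andbF.
by rewrite /rank_lt ltnn !andbF.
Qed.

End OffDiagonal.

Section Graph.
Variable V : finType.
Implicit Types (J : {set V * V}).

Definition graph_edges J : {set V * V} :=
  [set e | (rank_lt e && (e \in J)) || (rank_lt (e.2, e.1) && ((e.2, e.1) \in J))].

Lemma graph_edges_simple J : simple_edges (graph_edges J).
Proof.
apply/andP; split; apply/forallP => u.
  by rewrite inE /= orbb /rank_lt ltnn.
by apply/forallP => v; rewrite !inE /= orbC.
Qed.

Definition graph_of J : sgraph V := SGraph (graph_edges_simple J).

Lemma adj_graph_of J u v : adj (graph_of J) u v =
  (rank_lt (u, v) && ((u, v) \in J)) || (rank_lt (v, u) && ((v, u) \in J)).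
Proof. by rewrite /adj /= inE. Qed.

Definition rank_pairs : {set V * V} := [set e | rank_lt e].

Definition independent (G : sgraph V) (S : {set V}) : bool :=
  [forall u in S, forall v in S, ~~ adj G u v].

Definition inner_pairs (S : {set V}) : {set V * V} :=
  [set e | [&& rank_lt e, e.1 \in S & e.2 \in S]].

Lemma avoids_inner_pairs J S : avoids (inner_pairs S) J = independent (graph_of J) S.
Proof.
apply/idP/idP => [/pred0P av|/forall_inP ind].
  apply/forall_inP => u uS; apply/forall_inP => v vS; rewrite adj_graph_of negb_or.
  have := av (u, v); have := av (v, u); rewrite /= !inE /= uS vS !andbT => -> ->.
  by [].
rewrite /avoids -setI_eq0; apply/eqP/setP => -[u v]; rewrite !inE /=; apply/negP => /andP[/and3P[uv uS vS] uvJ].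
have /forall_inP/(_ v vS) := ind u uS.
by rewrite adj_graph_of uv uvJ.
Qed.

End Graph.

Section Sbm.
Variables (R : realType) (k : nat) (n : 'I_k -> nat) (P : 'M[R]_k).
Hypothesis P_sym : forall i j, P i j = P j i.
Hypothesis P_itv : forall i j, 0 <= P i j < 1.
Local Notation V := (sbm_vertex n).
Local Notation Q := (logQ P).

Definition edge_prob (e : V * V) : R := P (tag e.1) (tag e.2).

(** On subsets of [rank_pairs] the map [graph_of] is a bijection onto the graphs, and it carries the
    product weight of [bexp] to [sbm_weight]. *)
Lemma sbm_PrE (A : pred (sgraph V)) :
  sbm_Pr P A = bexp edge_prob (rank_pairs V) (fun J => (A (graph_of J))%:R).
Proof.
rewrite /sbm_Pr /bexp.
rewrite (reindex_onto (@graph_of V) (fun G => edges G :&: rank_pairs V)) /=; last first.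
  move=> G _; apply: val_inj; apply/setP => -[u v] /=; rewrite !inE /=.
  rewrite -/(adj G u v) -/(adj G v u) (adj_sym G v u).
  have [->|uv] := eqVneq u v; first by rewrite adj_irr !andbF.
  by rewrite (rank_lt_total uv); case: (adj G u v); case: (rank_lt _).
have adjE (J : {set V * V}) u v : rank_lt (u, v) -> adj (graph_of J) u v = ((u, v) \in J).
  move=> uv; rewrite adj_graph_of uv /=.
  have vu : v != u by rewrite eq_sym; apply: (rank_lt_neq uv).
  by rewrite (rank_lt_total vu) uv orbF.
rewrite big_mkcond [RHS]big_mkcond; apply: eq_bigr => J _.
have -> : (edges (graph_of J) :&: rank_pairs V == J) = (J \subset rank_pairs V).
  apply/eqP/idP => [<-|/subsetP JD]; first by rewrite subsetIr.
  apply/setP => -[u v]; rewrite in_setI [X in _ && X]inE.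
  case: (boolP (rank_lt (u, v))) => uv; first by rewrite andbT; apply: adjE.
  by rewrite andbF; apply/esym; apply: contraNF uv => /JD; rewrite inE.
case: (J \subset _); rewrite ?andbF ?andbT //.
case: (A _); last by rewrite mulr0.
rewrite mulr1 /sbm_weight; apply: eq_big => [e|[u v] uv]; first by rewrite inE.
by rewrite /= adjE.
Qed.

Lemma edge_prob_itv e : 0 <= edge_prob e <= 1.
Proof. by have /andP[-> /ltW ->] := P_itv (tag e.1) (tag e.2). Qed.

Lemma le_sbm_Pr (A B : pred (sgraph V)) :
  (forall G, A G -> B G) -> sbm_Pr P A <= sbm_Pr P B.
Proof.
move=> AB; rewrite !sbm_PrE; apply: le_bexp => [e|J]; first exact: edge_prob_itv.
by rewrite ler_nat; case: (boolP (A _)) => // /AB ->.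
Qed.

Lemma sbm_Pr_union (X : finType) (A : X -> pred (sgraph V)) (b : R) :
  (forall x, sbm_Pr P (A x) <= b) ->
  sbm_Pr P (fun G => [exists x, A x G]) <= #|X|%:R * b.
Proof.
move=> Ab; apply: (@le_trans _ _ (\sum_x sbm_Pr P (A x))); last first.
  by rewrite mulr_natl -sumr_const; apply: ler_sum => x _; apply: Ab.
rewrite sbm_PrE; under eq_bigr => x _ do rewrite sbm_PrE.
rewrite -bexp_sum; apply: le_bexp => [e|J]; first exact: edge_prob_itv.
case: existsP => [[x Ax]|_]; last by apply: sumr_ge0 => x _; rewrite ler0n.
by rewrite (bigD1 x) //= Ax lerDl sumr_ge0.
Qed.

Lemma logQ_sym i j : Q i j = Q j i.
Proof. by rewrite !mxE P_sym. Qed.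

Lemma expR_logQ i j : expR (- Q i j) = 1 - P i j.
Proof.
have /andP[P0 P1] := P_itv i j.
by rewrite mxE div1r lnV ?posrE ?subr_gt0 // opprK lnK ?posrE ?subr_gt0.
Qed.

Lemma logQ_ge0 i j : 0 <= Q i j.
Proof.
have /andP[P0 P1] := P_itv i j.
by rewrite mxE ln_ge0 // div1r invf_ge1 ?subr_gt0 //; lra.
Qed.

Definition vertex_energy (S : {set V}) : R :=
  2^-1 * \sum_(u in S) \sum_(v in S | v != u) Q (tag u) (tag v).

Lemma pavoid_inner_pairs S :
  pavoid edge_prob (inner_pairs S) = expR (- vertex_energy S).
Proof.
rewrite /vertex_energy -(sum_rank_lt S (q := fun u v : V => Q (tag u) (tag v))); last first.
  by move=> u v; rewrite logQ_sym.
rewrite -sumrN expR_sum /pavoid.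
apply: eq_big => [e|e _]; first by rewrite inE.
by rewrite expR_logQ.
Qed.

(** The pairs inside both sets are the pairs inside [S :&: S']; the last factor corrects their being
    counted twice. *)
Lemma pavoid_inner_pairsU S S' :
  pavoid edge_prob (inner_pairs S :|: inner_pairs S') =
  expR (- vertex_energy S) * expR (- vertex_energy S') *
    expR (vertex_energy (S :&: S')).
Proof.
have IE : inner_pairs S :&: inner_pairs S' = inner_pairs (S :&: S').
  by apply/setP => e; rewrite !inE; do ! case: (_ \in _); rewrite ?andbF ?andbT ?andbb.
have split (B C : {set V * V}) : pavoid edge_prob B =
    pavoid edge_prob (B :&: C) * pavoid edge_prob (B :\: C).
  by rewrite /pavoid (big_setID C).
have := split (inner_pairs S :|: inner_pairs S') (inner_pairs S).
rewrite setUK setDUl setDv set0U => ->.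
have := split (inner_pairs S') (inner_pairs S).
rewrite setIC IE !pavoid_inner_pairs => ->.
by rewrite -mulrA mulrAC -expRD addNr expR0 mul1r.
Qed.

Section Transversal.
Variables (A : finType) (m : nat) (g : A -> 'I_m -> V) (ty : A -> 'I_k).
Hypothesis g_inj : forall a b a' b', g a b = g a' b' -> a = a' /\ b = b'.
Hypothesis g_tag : forall a b, tag (g a b) = ty a.

(** Every slot [a] has [m] candidates of its own. Using one candidate per slot, rather than all sets
    with the given profile, gives the family a product structure: two members meet exactly in the
    slots where they agree, and a uniform member agrees with a fixed one on [I] with probability
    m^(- |I|). *)
Definition transversal (f : {ffun A -> 'I_m}) : {set V} := [set g a (f a) | a in A].

Definition type_energy (I : {set A}) : R :=
  2^-1 * \sum_(a in I) \sum_(b in I | b != a) Q (ty a) (ty b).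

Lemma vertex_energy_imset (f : {ffun A -> 'I_m}) (I : {set A}) :
  vertex_energy [set g a (f a) | a in I] = type_energy I.
Proof.
have inj : {in I &, injective (fun a => g a (f a))} by move=> a b _ _ /g_inj[].
rewrite /vertex_energy /type_energy big_imset //=; congr (_ * _).
apply: eq_bigr => a aI; rewrite big_mkcondr big_imset //= -big_mkcondr /=.
apply: eq_big => [b|b _]; last by rewrite !g_tag.
congr (_ && _); congr negb; apply/eqP/eqP => [/g_inj[]//|-> //].
Qed.

Lemma transversalI (f f' : {ffun A -> 'I_m}) :
  transversal f :&: transversal f' = [set g a (f a) | a in [set a | f a == f' a]].
Proof.
apply/setP => v; rewrite inE; apply/andP/imsetP.
  move=> [/imsetP[a _ ->] /imsetP[a' _ /g_inj[aa' ff']]].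
  by exists a => //; rewrite inE ff' aa'.
move=> [a]; rewrite inE => /eqP ff' ->.
by split; apply/imsetP; exists a => //; rewrite ff'.
Qed.

Lemma card_ffun_agree (f : {ffun A -> 'I_m}) (I : {set A}) :
  #|[set f' : {ffun A -> 'I_m} | I \subset [set a | f a == f' a]]| = (m ^ #|~: I|)%N.
Proof.
pose F a : pred 'I_m := if a \in I then pred1 (f a) else predT.
rewrite -[LHS](_ : #|family F| = _); last first.
  apply: eq_card => f'; rewrite inE; apply/familyP/subsetP => [fF a aI|sub a].
    by have := fF a; rewrite /F aI !inE eq_sym.
  by rewrite /F; case: ifP => // /sub; rewrite !inE eq_sym.
rewrite card_family foldrE big_map big_enum /= (bigID (fun a => a \in I)) /=.
rewrite big1 => [|a aI]; last by rewrite /F aI card1.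
rewrite mul1n; under eq_bigr => a aI do rewrite /F (negPf aI).
rewrite -(prod_nat_const (mem (~: I))) /=; apply: eq_big => [a|a _]; first by rewrite inE.
by rewrite cardT size_enum_ord.
Qed.

(** Two transversals are both independent with probability q^2 times the exponential of the energy
    of their agreement set, so averaging over one of them bounds the [d] of [janson_family] by a sum
    over possible agreement sets. Sharing a pair of vertices means agreeing in at least two slots,
    hence [1 < #|I|]. *)
Lemma pr_no_independent_transversal (d : R) : (0 < m)%N -> 0 < d ->
  \sum_(I : {set A} | (1 < #|I|)%N) expR (type_energy I) / m%:R ^+ #|I| <= d ->
  sbm_Pr P (fun G => [forall f, ~~ independent G (transversal f)])
    <= expR (1 - (2 * d)^-1).
Proof.
move=> m0 d0 sd; rewrite sbm_PrE.
under eq_bexp => J.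
  rewrite (_ : [forall f, _] = [forall f, ~~ avoids (inner_pairs (transversal f)) J]); last first.
    by apply: eq_forallb => f; rewrite avoids_inner_pairs.
  over.
have energyT f : vertex_energy (transversal f) = type_energy [set: A].
  by rewrite -(vertex_energy_imset f); congr vertex_energy; apply/setP => v;
    apply/imsetP/imsetP => -[a _ ->]; exists a.
have energy_ge0 (I : {set A}) : 0 <= type_energy I.
  rewrite mulr_ge0 ?invr_ge0 ?ler0n //; apply: sumr_ge0 => a _; apply: sumr_ge0 => b _.
  exact: logQ_ge0.
have m0R : 0 < m%:R :> R by rewrite ltr0n.
apply: (@janson_family _ _ _ edge_prob_itv _ _ (expR (- type_energy [set: A]))) => //.
- by rewrite card_ffun expn_gt0 card_ord m0.
- exact: expR_gt0.
- by rewrite -expR0 ler_expR oppr_le0.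
- by move=> f; apply/subsetP => e; rewrite !inE => /andP[].
- by move=> f; rewrite pavoid_inner_pairs energyT.
move=> f; set q := expR _.
pose ag (f' : {ffun A -> 'I_m}) := [set a | f a == f' a].
have agE f' : pavoid edge_prob (inner_pairs (transversal f') :|: inner_pairs (transversal f)) =
    q ^+ 2 * expR (type_energy (ag f')).
  rewrite setUC pavoid_inner_pairsU !energyT transversalI vertex_energy_imset.
  by rewrite expr2.
under eq_bigr => f' _ do rewrite agE.
rewrite -mulr_sumr mulrCA ler_wpM2l ?exprn_ge0 ?expR_ge0 //.
(* The term [I = ag f'] alone gives the bound; admitting every [I] inside the agreement set makes
   the number of [f'] belonging to [I] a plain power of [m]. *)
apply: (@le_trans _ _ (\sum_f' \sum_(I : {set A} | (1 < #|I|)%N)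
    if I \subset ag f' then expR (type_energy I) else 0)).
  rewrite big_mkcond /=; apply: ler_sum => f' _; case: ifP => [|_]; last first.
    by apply: sumr_ge0 => I _; case: ifP => // _; apply: expR_ge0.
  rewrite -setI_eq0 => /set0Pn[e]; rewrite inE => /andP[].
  rewrite !inE => /and3P[lt1 e1' e2'] /and3P[_ e1 e2].
  have : e.1 \in transversal f :&: transversal f' by rewrite inE e1 e1'.
  have : e.2 \in transversal f :&: transversal f' by rewrite inE e2 e2'.
  rewrite transversalI => /imsetP[b bI eb] /imsetP[a aI ea].
  have ab : a != b by apply: contraTneq lt1 => ab; rewrite /rank_lt ea eb ab ltnn.
  rewrite (bigD1 (ag f')) /=; last first.
    rewrite (cardD1 a) aI (cardD1 b) inE /= eq_sym ab /= bI //.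
  rewrite subxx lerDl; apply: sumr_ge0 => I _.
  by case: ifP => // _; apply: expR_ge0.
rewrite exchange_big /=.
apply: (@le_trans _ _ (\sum_(I : {set A} | (1 < #|I|)%N)
   #|{ffun A -> 'I_m}|%:R * (expR (type_energy I) / m%:R ^+ #|I|))); last first.
  by rewrite -mulr_sumr ler_wpM2l.
apply: ler_sum => I _; rewrite -big_mkcond /= sumr_const -[leLHS]mulr_natr mulrCA.
rewrite ler_wpM2l ?expR_ge0 // card_ffun card_ord.
have -> : #|[pred f' | I \subset ag f']| = (m ^ #|~: I|)%N.
  by rewrite -(card_ffun_agree f I) cardsE.
by rewrite -(cardsC I) expnD natrM !natrX mulrAC mulfV ?mul1r // expf_neq0 // gt_eqF.
Qed.

End Transversal.

End Sbm.

(** * Independent sets with a prescribed profile *)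

Section Profiles.
Variables (R : realType) (k : nat) (n : 'I_k -> nat) (P : 'M[R]_k).
Hypothesis P_sym : forall i j, P i j = P j i.
Hypothesis P_itv : forall i j, 0 <= P i j < 1.
Local Notation V := (sbm_vertex n).
Local Notation Q := (logQ P).

Definition block (i : 'I_k) : {set V} := [set v | tag v == i].

Definition has_profile (G : sgraph V) (U : {set V}) (z : 'I_k -> nat) : bool :=
  [exists S : {set V}, [&& S \subset U, independent G S &
     [forall i, #|S :&: block i| == z i]]].

(** In the enumeration of [U :&: block i], the slot numbered c gets the vertices in positions c m,
    ..., c m + m - 1 as candidates. These runs are disjoint and fit because m z_i <= |U :&: block
    i|, so the transversals are sets of profile [z] in [U]. *)
Lemma pr_no_profile (U : {set V}) (z : 'I_k -> nat) (m : nat) (d : R) :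
  (0 < m)%N -> (forall i, m * z i <= #|U :&: block i|)%N -> 0 < d ->
  \sum_(I : {set {i : 'I_k & 'I_(z i)}} | (1 < #|I|)%N)
     expR (type_energy P tag I) / m%:R ^+ #|I| <= d ->
  sbm_Pr P (fun G => ~~ has_profile G U z) <= expR (1 - (2 * d)^-1).
Proof.
move=> m0 zU d0 sd; pose A : finType := {i : 'I_k & 'I_(z i)}.
have lt_idx (a : A) (b : 'I_m) : (tagged a * m + b < #|U :&: block (tag a)|)%N.
  apply: leq_trans (zU (tag a)); rewrite mulnC.
  apply: (@leq_trans (m * (tagged a).+1)); last by rewrite leq_mul2l ltn_ord orbT.
  by rewrite mulnS addnC ltn_add2r.
pose g (a : A) (b : 'I_m) : V := enum_val (Ordinal (lt_idx a b)).
have g_in a b : g a b \in U :&: block (tag a) by apply: enum_valP.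
have g_tag a b : tag (g a b) = tag a.
  by have := g_in a b; rewrite !inE => /andP[_ /eqP].
have g_inj a b a' b' : g a b = g a' b' -> a = a' /\ b = b'.
  move=> gg; have tt : tag a = tag a' by rewrite -(g_tag a b) -(g_tag a' b') gg.
  case: a a' tt gg => [i c] [i' c'] /= tt; move: c'; rewrite -{}tt => c' {i'}.
  move=> /enum_val_inj [] idx.
  have bb : (b : nat) = b'.
    by have := congr1 (modn^~ m) idx; rewrite /= !modnMDl !modn_small.
  have cc : (c : nat) = c'.
    by move/eqP: idx; rewrite bb eqn_add2r eqn_pmul2r // => /eqP.
  by split; [congr (Tagged _ _); apply: val_inj | apply: val_inj].
apply: le_trans (pr_no_independent_transversal P_sym P_itv g_inj g_tag m0 d0 sd).
apply: le_sbm_Pr => // G; apply: contraNT; rewrite negb_forall => /existsP[f].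
rewrite negbK => ind; apply/existsP; exists (transversal g f).
apply/and3P; split=> //.
  by apply/subsetP => v /imsetP[a _ ->]; have := g_in a (f a); rewrite inE => /andP[].
apply/forallP => i; apply/eqP.
pose tg (c : 'I_(z i)) : A := Tagged (fun i => 'I_(z i)) c.
have -> : transversal g f :&: block i = [set g (tg c) (f (tg c)) | c in 'I_(z i)].
  apply/setP => v; rewrite !inE; apply/andP/imsetP.
    move=> [/imsetP[[j c] _ ->]]; rewrite g_tag /= => /eqP ji.
    by move: c; rewrite ji => c; exists c.
  move=> [c _ ->]; rewrite g_tag eqxx; split=> //.
  by apply/imsetP; exists (tg c).
rewrite card_in_imset ?card_ord // => c c' _ _ /g_inj[/eqP].
by rewrite /tg eq_Tagged => /eqP.
Qed.

(** Adding the diagonal pairs turns the double sum into the quadratic form of the vector of type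
    counts. *)
Lemma type_energy_le (A : finType) (ty : A -> 'I_k) (I : {set A})
    (v : 'cV[R]_k) : (forall i, v i 0 = #|[set a in I | ty a == i]|%:R) ->
  type_energy P ty I <= 2^-1 * (v^T *m Q *m v) 0 0.
Proof.
move=> vE; rewrite ler_wpM2l ?invr_ge0 //.
apply: (@le_trans _ _ (\sum_(a in I) \sum_(b in I) Q (ty a) (ty b))).
  apply: ler_sum => a _; rewrite [leRHS](bigID (fun b => b != a)) /= lerDl.
  by apply: sumr_ge0 => b _; apply: (logQ_ge0 P_itv).
have card_v F i : \sum_(a in I | ty a == i) F (ty a) = v i 0 * F i.
  rewrite (eq_bigr (fun=> F i)) => [|a /andP[_ /eqP -> //]].
  rewrite sumr_const vE -[LHS]mulr_natl; congr (_%:R * _).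
  by apply: eq_card => a; rewrite !inE.
rewrite mxE (partition_big ty predT) //=.
under eq_bigr => i _.
  rewrite (eq_bigr (fun a => \sum_j Q (ty a) j * v j 0)); last first.
    move=> a _; rewrite (partition_big ty predT) //=.
    by apply: eq_bigr => j _; rewrite (card_v (fun x => Q (ty a) x)) mulrC.
  rewrite (card_v (fun x => \sum_j Q x j * v j 0)) mulr_sumr.
  over.
rewrite exchange_big /= le_eqVlt; apply/orP; left; apply/eqP.
apply: eq_bigr => j _; rewrite mxE mulr_suml.
by apply: eq_bigr => i _; rewrite mulrA; congr (_ * _ * _); rewrite [RHS]mxE.
Qed.

Lemma cards_type (A : finType) (ty : A -> 'I_k) (I : {set A}) :
  (\sum_i #|[set a in I | ty a == i]|)%N = #|I|.
Proof.
rewrite -[RHS]sum1_card (partition_big ty predT) //=.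
by apply: eq_bigr => i _; rewrite -sum1_card; apply: eq_bigl => a; rewrite inE.
Qed.

Lemma card_type_le (z : 'I_k -> nat) (I : {set {i : 'I_k & 'I_(z i)}}) i :
  (#|[set a in I | tag a == i]| <= z i)%N.
Proof.
pose tg (c : 'I_(z i)) := Tagged (fun i => 'I_(z i)) c.
rewrite -[leqRHS]card_ord; apply: leq_trans (leq_imset_card tg 'I_(z i)).
apply/subset_leq_card/subsetP => -[j c]; rewrite !inE /= => /andP[_ /eqP ji].
by move: c; rewrite ji => c; apply/imsetP; exists c.
Qed.

End Profiles.

(** * Sums over subsets, grouped by size *)

Section SubsetSums.
Variable R : realType.

Lemma sum_card_set (A : finType) (F : nat -> R) :
  \sum_(I : {set A} | (1 < #|I|)%N) F #|I| =
  \sum_(s < #|A|.+1 | (1 < s)%N) 'C(#|A|, s)%:R * F s.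
Proof.
rewrite (partition_big (fun I : {set A} => inord #|I| : 'I_#|A|.+1)
   (fun s => (1 < s)%N)) /=; last first.
  by move=> I; rewrite inordK // ltnS max_card.
apply: eq_bigr => s s1; rewrite (eq_bigr (fun=> F s)) => [|I /andP[_ /eqP <-]]; last first.
  by rewrite inordK // ltnS max_card.
rewrite sumr_const -card_draws -[LHS]mulr_natl; congr (_%:R * _).
rewrite -sum1_card -[RHS]sum1_card; apply: eq_bigl => I.
rewrite [RHS]inE unfold_in -val_eqE /= inordK ?ltnS ?max_card //.
by case: eqP => [->|]; rewrite ?s1 ?andbF.
Qed.

Lemma sum_geometric (y : R) (a l : nat) : 0 <= y <= 1 / 2 ->
  \sum_(s < l | (a <= s)%N) y ^+ s <= 2 * y ^+ a.
Proof.
move=> /andP[y0 y1].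
(* The subtracted term 2 y^l leaves room for the next summand, since 2 y^(l+1) <= y^l. *)
suff H : \sum_(s < l | (a <= s)%N) y ^+ s <= 2 * y ^+ a - (if (a <= l)%N then 2 * y ^+ l else 0).
  by apply: le_trans H _; rewrite lerBlDr lerDl; case: ifP => // _; rewrite mulr_ge0 // exprn_ge0.
elim: l => [|l IH].
  rewrite big_ord0; case: a => [|a] /=; first by rewrite subrr.
  by rewrite subr0 mulr_ge0 // exprn_ge0.
rewrite big_mkcond big_ord_recr -big_mkcond /=.
have yl : y ^+ l.+1 <= 1 / 2 * y ^+ l by rewrite exprS ler_wpM2r // exprn_ge0.
set p := y ^+ l in yl IH *; set q := y ^+ l.+1 in yl *.
have [al|la] := leqP a l.
  by rewrite al in IH; rewrite leqW //; lra.
rewrite leqNgt la /= in IH; rewrite addr0.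
case: ifP => al; last by rewrite subr0; lra.
have al1 : a = l.+1 by apply/eqP; rewrite eqn_leq al.
by rewrite al1 -/q in IH *; rewrite subrr big1 // => s; rewrite leqNgt ltnS (ltnW (ltn_ord s)).
Qed.

Lemma ffact_le_exp (T s : nat) : (T ^_ s <= T ^ s)%N.
Proof.
rewrite ffact_prod; elim: s => [|s IH]; first by rewrite big_ord0.
by rewrite big_ord_recr /= expnSr leq_mul // leq_subr.
Qed.

Lemma bin_le_exp (T s : nat) : 'C(T, s)%:R <= T%:R ^+ s :> R.
Proof.
rewrite -natrX ler_nat; apply: leq_trans (ffact_le_exp T s).
by rewrite -bin_ffact leq_pmulr // fact_gt0.
Qed.

(** The bound (e T / s)^s, from s^s <= e^s s!, with [s] in the base weakened to [s0] so that the sum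
    over [s] becomes geometric. *)
Lemma bin_le_expM (T s : nat) (s0 : R) : 0 < s0 -> s0 <= s%:R ->
  'C(T, s)%:R <= (expR 1 * T%:R / s0) ^+ s :> R.
Proof.
move=> s00 s0s; have f0 : 0 < s`!%:R :> R by rewrite ltr0n fact_gt0.
have C1 : 'C(T, s)%:R * s`!%:R <= T%:R ^+ s :> R.
  by rewrite -natrM -natrX ler_nat bin_ffact ffact_le_exp.
have C2 : s%:R ^+ s <= expR 1 ^+ s * s`!%:R :> R.
  case: s s0s {C1} f0 => [|s] s0s f0; first by rewrite !expr0 !mul1r.
  rewrite -ler_pdivrMr // -expRM_natl mulr1.
  apply: le_trans (expR_ge1Dxn s (ler0n R s.+1)); first by rewrite lerDr.
have s00s : 0 < s0 ^+ s by rewrite exprn_gt0.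
rewrite expr_div_n exprMn ler_pdivlMr // -(ler_pM2r f0).
apply: (@le_trans _ _ (T%:R ^+ s * s%:R ^+ s)).
  rewrite mulrAC; apply: ler_pM => //; first by rewrite mulr_ge0.
    exact: ltW.
  by apply: lerXn2r => //; rewrite nnegrE // ltW.
by rewrite [leRHS]mulrAC mulrC ler_wpM2r // exprn_ge0.
Qed.

(* [x] bounds the contribution of the small subsets, [y] that of the others. *)
Lemma subset_sum_two_scales (A : finType) (E : {set A} -> R) (m c : nat)
    (lam rho s0 x y : R) : (0 < m)%N ->
  0 < s0 -> c%:R <= s0 -> x <= 1 / 2 -> y <= 1 / 2 ->
  (forall I : {set A}, E I <= lam * #|I|%:R) ->
  (forall I : {set A}, #|I|%:R < s0 -> E I <= rho * #|I|%:R) ->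
  #|A|%:R * expR rho / m%:R <= x ->
  expR 1 * #|A|%:R / s0 * expR lam / m%:R <= y ->
  \sum_(I : {set A} | (1 < #|I|)%N) expR (E I) / m%:R ^+ #|I|
    <= 2 * x ^+ 2 + 2 * y ^+ c.
Proof.
move=> m0 s00 cs0 x1 y1 E1 E2 hx hy; have m0R : 0 < m%:R :> R by rewrite ltr0n.
have x0 : 0 <= x by apply: le_trans hx; rewrite !mulr_ge0 ?invr_ge0 ?expR_ge0 // ltW.
have y0 : 0 <= y.
  by apply: le_trans hy; rewrite !mulr_ge0 ?invr_ge0 ?expR_ge0 // ltW.
pose F (s : nat) : R := (if s%:R < s0 then expR (rho * s%:R) else expR (lam * s%:R)) / m%:R ^+ s.
apply: (@le_trans _ _ (\sum_(I : {set A} | (1 < #|I|)%N) F #|I|)).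
  apply: ler_sum => I _; rewrite ler_wpM2r ?invr_ge0 ?exprn_ge0 //.
  by case: ifP => h; rewrite ler_expR // E2.
rewrite sum_card_set.
have x01 : 0 <= x <= 1 / 2 by apply/andP.
have y01 : 0 <= y <= 1 / 2 by apply/andP.
(* Sizes below [s0] are charged to the powers of [x], starting at 2; the others to the powers of
   [y], which may start at [c] because c <= s0. *)
apply: le_trans (lerD (sum_geometric 2 #|A|.+1 x01) (sum_geometric c #|A|.+1 y01)).
rewrite [X in _ <= _ + X]big_mkcond [X in _ <= X + _]big_mkcond -big_split /= big_mkcond /=.
apply: ler_sum => s _; case: ifP => s1; last by rewrite add0r; case: ifP; rewrite ?exprn_ge0.
rewrite /F; case: ifP => hs.
  apply: (@le_trans _ _ (x ^+ s)); last by rewrite lerDl; case: ifP; rewrite ?exprn_ge0.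
  apply: le_trans (lerXn2r s _ _ hx); rewrite ?nnegrE //; last first.
    by rewrite !mulr_ge0 ?invr_ge0 ?expR_ge0 // ltW.
  rewrite expr_div_n exprMn expRM_natr mulrA ler_wpM2r ?invr_ge0 ?exprn_ge0 //.
  by rewrite ler_wpM2r ?exprn_ge0 ?expR_ge0 // bin_le_exp.
move/negbT: hs; rewrite -leNgt => hs.
have -> : (c <= s)%N by rewrite -(ler_nat R); apply: le_trans hs.
rewrite ler_wpDl ?exprn_ge0 //.
apply: le_trans (lerXn2r s _ _ hy); rewrite ?nnegrE //; last first.
  by rewrite !mulr_ge0 ?invr_ge0 ?expR_ge0 // ltW.
rewrite expr_div_n exprMn expRM_natr mulrA ler_wpM2r ?invr_ge0 ?exprn_ge0 //.
by rewrite ler_wpM2r ?exprn_ge0 ?expR_ge0 // bin_le_expM.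
Qed.

End SubsetSums.

(** * Greedy colourings *)

Section Coloring.
Variables (V : finType) (G : sgraph V).
Implicit Types (U S : {set V}) (c : nat).

Definition colorable_on U c : Prop :=
  exists2 f : V -> nat, (forall u, u \in U -> (f u < c)%N) &
    forall u v, u \in U -> v \in U -> adj G u v -> f u <> f v.

Lemma colorable_on0 : colorable_on set0 0.
Proof. by exists (fun=> 0%N) => [u|u v]; rewrite inE. Qed.

Lemma independentP S u v : independent G S -> u \in S -> v \in S -> ~~ adj G u v.
Proof. by move=> /forall_inP h /h /forall_inP; apply. Qed.

Lemma colorable_onS U S c :
  independent G S -> colorable_on (U :\: S) c -> colorable_on U c.+1.
Proof.
move=> indS [f fc fadj]; exists (fun u => if u \in S then c else f u) => [u uU|u v uU vU uv].
  by case: ifP => // uS; rewrite ltnS ltnW // fc // inE uS.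
case: ifP => uS; case: ifP => vS.
- by have := independentP indS uS vS; rewrite uv.
- by move=> cE; have := fc v; rewrite inE vS vU -cE ltnn => /(_ isT).
- by move=> cE; have := fc u; rewrite inE uS uU cE ltnn => /(_ isT).
- by apply: fadj => //; rewrite inE ?uS ?vS.
Qed.

Lemma colorable_onU U U' c c' :
  colorable_on U c -> colorable_on U' c' -> colorable_on (U :|: U') (c + c').
Proof.
move=> [f fc fadj] [f' fc' fadj'].
exists (fun u => if u \in U then f u else (c + f' u)%N) => [u|u v].
  rewrite inE; case: ifP => /= uU; first by move=> _; rewrite ltn_addr ?fc.
  by move=> uU'; rewrite ltn_add2l fc'.
rewrite !inE; case: ifP => uU /= uU'; case: ifP => vU /= vU' uv.
- exact: fadj.
- by move=> e; have := fc u uU; rewrite e ltnNge leq_addr.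
- by move=> e; have := fc v vU; rewrite -e ltnNge leq_addr.
- by move=> /addnI; apply: fadj'.
Qed.

Lemma colorable_on_bigcup (I : finType) (F : I -> {set V}) (c : I -> nat) (s : seq I) :
  (forall i, colorable_on (F i) (c i)) ->
  colorable_on (\bigcup_(i <- s) F i) (\sum_(i <- s) c i).
Proof.
move=> h; elim: s => [|i s IH]; first by rewrite !big_nil; apply: colorable_on0.
by rewrite !big_cons; apply: colorable_onU.
Qed.

Lemma chromatic_number_le c : colorable_on setT c -> (chromatic_number G <= c)%N.
Proof.
move=> [f fc fadj]; rewrite /chromatic_number; case: ex_minnP => c' _; apply.
apply/existsP; exists [ffun u => Ordinal (fc u (in_setT u))].
apply/forallP => u; apply/forallP => v; apply/implyP => uv; rewrite !ffunE.
by apply/eqP => /(congr1 val) /=; apply: fadj.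
Qed.

(* The potential [#|U| / t + a ln #|U| + 1] drops by at least [1] whenever an
   independent set with [t] vertices or with [#|U| / a] vertices is removed. *)
Lemma colorable_on_greedy (R : realType) (X : {set V}) (t a : R) : 0 < t -> 0 < a ->
  (forall U, U \subset X -> U != set0 -> exists S, [/\ S \subset U, independent G S, S != set0 &
      t <= #|S|%:R \/ #|U|%:R <= a * #|S|%:R]) ->
  forall U, U \subset X -> exists2 c, colorable_on U c &
    U != set0 -> c%:R <= #|U|%:R / t + a * ln #|U|%:R + 1.
Proof.
move=> t0 a0 hS U; move En : #|U| => u.
elim/ltn_ind: u U En => u IH U En UX.
have [->|U0] := eqVneq U set0; first by exists 0%N => //; apply: colorable_on0.
have [S [SU indS S0 hs]] := hS U UX U0.
have Sgt : (0 < #|S|)%N by rewrite card_gt0.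
have cU : #|U| = (#|S| + #|U :\: S|)%N.
  by rewrite (cardsD U S) (setIidPr SU) subnKC // subset_leq_card.
have u1 : 1 <= u%:R :> R by rewrite ler1n -En card_gt0.
(* The last set is paid for by the summand 1 of the potential, as the logarithm gives no drop
   towards the empty set. *)
have [E|NE] := eqVneq (U :\: S) set0.
  exists 1%N; first by apply: (colorable_onS indS); rewrite E; apply: colorable_on0.
  move=> _; rewrite lerDr addr_ge0 ?divr_ge0 ?mulr_ge0 ?ln_ge0 ?(ltW t0) ?(ltW a0) //.
have [|c col cle] := IH #|U :\: S| _ (U :\: S) erefl (subset_trans (subsetDl _ _) UX).
  by rewrite -En cU -[ltnLHS]add0n ltn_add2r.
exists c.+1; first exact: colorable_onS col.
move=> _; rewrite -natr1; apply: le_trans (lerD (cle NE) (lexx 1)) _.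
have uE : u%:R = #|S|%:R + #|U :\: S|%:R :> R by rewrite -natrD -cU En.
set v : R := #|U :\: S|%:R in uE *; set s : R := #|S|%:R in uE hs.
have v0 : 0 < v by rewrite ltr0n card_gt0.
have s0 : 0 < s by rewrite ltr0n.
rewrite uE lerD2r mulrDl.
have lnv : ln v <= ln (s + v) by rewrite ler_ln ?posrE ?addr_gt0 // lerDr ltW.
case: hs => [ts|us].
  have : 1 <= s / t by rewrite ler_pdivlMr // mul1r.
  have : a * ln v <= a * ln (s + v) by rewrite ler_wpM2l // ltW.
  lra.
have : 0 <= s / t by rewrite divr_ge0 // ltW.
suff : a * ln v + 1 <= a * ln (s + v) by lra.
rewrite En uE in us.
have sv0 : 0 < s + v by rewrite addr_gt0.
have lnv' : ln v <= ln (s + v) - s / (s + v).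
  have E : (s + v) * (1 - s / (s + v)) = v.
    by rewrite mulrBr mulr1 mulrCA divff ?gt_eqF // mulr1 addrAC subrr add0r.
  have h1 : s / (s + v) < 1 by rewrite ltr_pdivrMr // mul1r ltrDl.
  rewrite -{1}E lnM ?posrE ?subr_gt0 // lerD2l.
  by apply: le_ln1Dx; lra.
have : a * ln v <= a * (ln (s + v) - s / (s + v)) by rewrite ler_wpM2l // ltW.
have : 1 <= a * (s / (s + v)) by rewrite mulrA ler_pdivlMr // mul1r.
lra.
Qed.

End Coloring.

Section ProfileRemoval.
Variables (R : realType) (k : nat) (n : 'I_k -> nat) (G : sgraph (sbm_vertex n)).
Local Notation V := (sbm_vertex n).

Lemma card_block i : #|block n i| = n i.
Proof.
pose tg (c : 'I_(n i)) : V := Tagged (fun i => 'I_(n i)) c.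
have -> : block n i = [set tg c | c in 'I_(n i)].
  apply/setP => -[j c]; rewrite !inE /=; apply/eqP/imsetP => [ji|[c' _ /(congr1 tag)] //].
  by move: c; rewrite ji => c; exists c.
rewrite card_in_imset ?card_ord // => c c' _ _ /eqP.
by rewrite eq_Tagged => /eqP.
Qed.

Lemma card_sbm_vertex : #|V| = (\sum_i n i)%N.
Proof.
rewrite -[LHS]sum1_card (partition_big (@tag _ _ : V -> 'I_k) predT) //=.
by apply: eq_bigr => i _; rewrite -(card_block i) -sum1_card; apply: eq_bigl => v; rewrite !inE.
Qed.

Lemma colorable_on_blocks (U : {set V}) (c : 'I_k -> nat) :
  (forall i, colorable_on G (U :&: block n i) (c i)) ->
  colorable_on G U (\sum_i c i).
Proof.
move=> h; rewrite (_ : U = \bigcup_i (U :&: block n i)).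
  exact: (colorable_on_bigcup (index_enum 'I_k) h).
apply/setP => v; apply/idP/bigcupP => [vU|[i _]]; last by rewrite inE => /andP[].
by exists (tag v); rewrite // !inE vU eqxx.
Qed.

(** Reserving the total of all profiles on top of [lo] keeps every intermediate set above [lo], so
    each profile of the list is found in turn, at the price of one colour. *)
Lemma colorable_on_extract (J : Type) (z : J -> 'I_k -> nat) (lo : 'I_k -> R) :
  (forall j U, (forall i, lo i <= #|U :&: block n i|%:R) -> has_profile G U (z j)) ->
  forall (js : seq J) U,
  (forall i, lo i + (\sum_(j <- js) z j i)%:R <= #|U :&: block n i|%:R) ->
  exists2 U', (forall i, #|U' :&: block n i| + \sum_(j <- js) z j i = #|U :&: block n i|)%N &
    forall c, colorable_on G U' c -> colorable_on G U (c + size js).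
Proof.
move=> hz; elim=> [|j js IH] U hU.
  exists U => [i|c]; first by rewrite big_nil addn0.
  by rewrite addn0.
have /existsP[S /and3P[SU indS /forallP zS]] : has_profile G U (z j).
  by apply: hz => i; apply: le_trans (hU i); rewrite lerDl.
have cS i : (#|(U :\: S) :&: block n i| + z j i = #|U :&: block n i|)%N.
  rewrite -(eqP (zS i)) addnC -[RHS](cardsID S); congr (_ + _)%N.
    by congr #|pred_of_set _|; rewrite setIAC (setIidPr SU).
  by congr #|pred_of_set _|; rewrite setIDAC.
have [i|U' cU' col] := IH (U :\: S).
  by have := hU i; rewrite big_cons -cS !natrD; lra.
exists U' => [i|c /col]; first by rewrite big_cons -cS -cU' -addnA (addnC (z j i)).
by rewrite addnS; apply: colorable_onS.
Qed.

End ProfileRemoval.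

(** * Quadratic forms *)

Section QuadraticForm.
Variables (R : realType) (k : nat).
Implicit Types (x y : 'cV[R]_k) (c : R) (Q : 'M[R]_k).

Definition qform Q y : R := (y^T *m Q *m y) 0 0.

Definition nonneg y : Prop := forall i, 0 <= y i 0.

Lemma qformE Q y : qform Q y = \sum_i \sum_j y i 0 * Q i j * y j 0.
Proof.
rewrite /qform mxE exchange_big /=; apply: eq_bigr => j _.
by rewrite mxE mulr_suml; apply: eq_bigr => i _; rewrite mxE.
Qed.

Lemma qform_ge0 Q y : (forall i j, 0 <= Q i j) -> nonneg y -> 0 <= qform Q y.
Proof.
move=> Q0 y0; rewrite qformE; apply: sumr_ge0 => i _; apply: sumr_ge0 => j _.
by rewrite !mulr_ge0.
Qed.

Lemma qformZ Q c y : qform Q (c *: y) = c ^+ 2 * qform Q y.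
Proof.
rewrite !qformE mulr_sumr; apply: eq_bigr => i _; rewrite mulr_sumr.
by apply: eq_bigr => j _; rewrite !mxE; lra.
Qed.

Lemma norm1Z c y : 0 <= c -> norm1 (c *: y) = c * norm1 y.
Proof.
move=> c0; rewrite /norm1 mulr_sumr; apply: eq_bigr => i _.
by rewrite mxE normrM (ger0_norm c0).
Qed.

Lemma norm1_nonneg y : nonneg y -> norm1 y = \sum_i y i 0.
Proof. by move=> y0; apply: eq_bigr => i _; rewrite ger0_norm. Qed.

Lemma norm1_ge0 y : 0 <= norm1 y.
Proof. by apply: sumr_ge0. Qed.

Lemma norm1_sum (J : finType) (Y : J -> 'cV[R]_k) : (forall j, nonneg (Y j)) ->
  norm1 (\sum_j Y j) = \sum_j norm1 (Y j).
Proof.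
move=> Y0; rewrite norm1_nonneg => [|i]; last first.
  by rewrite summxE; apply: sumr_ge0 => j _; apply: Y0.
under [RHS]eq_bigr => j _ do rewrite norm1_nonneg //.
by rewrite exchange_big /=; apply: eq_bigr => i _; rewrite summxE.
Qed.

Lemma coord_le_norm1 y i : nonneg y -> y i 0 <= norm1 y.
Proof. by move=> y0; rewrite norm1_nonneg // (bigD1 i) //= lerDl sumr_ge0. Qed.

End QuadraticForm.

(** * Profiles of pieces *)

Section Pieces.
Variables (R : realType) (k : nat) (n : 'I_k -> nat) (P : 'M[R]_k).
Hypothesis P_sym : forall i j, P i j = P j i.
Hypothesis P_itv : forall i j, 0 <= P i j < 1.
Local Notation V := (sbm_vertex n).
Local Notation Q := (logQ P).

Definition profile_vec (z : 'I_k -> nat) (I : {set {i : 'I_k & 'I_(z i)}}) : 'cV[R]_k :=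
  \col_i #|[set a in I | tag a == i]|%:R.

Lemma profile_vec_nonneg z (I : {set {i : 'I_k & 'I_(z i)}}) : nonneg (profile_vec I).
Proof. by move=> i; rewrite mxE. Qed.

Lemma profile_vec_le z (I : {set {i : 'I_k & 'I_(z i)}}) i : profile_vec I i 0 <= (z i)%:R.
Proof. by rewrite mxE ler_nat card_type_le. Qed.

Lemma norm1_profile_vec z (I : {set {i : 'I_k & 'I_(z i)}}) : norm1 (profile_vec I) = #|I|%:R.
Proof.
rewrite norm1_nonneg; last exact: profile_vec_nonneg.
by rewrite -(cards_type tag I) natr_sum; apply: eq_bigr => i _; rewrite mxE.
Qed.

Lemma energy_profile_vec z (I : {set {i : 'I_k & 'I_(z i)}}) :
  type_energy P tag I <= 2^-1 * qform Q (profile_vec I).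
Proof. by apply: type_energy_le => // i; rewrite mxE. Qed.

Lemma card_profile_index (z : 'I_k -> nat) :
  #|{: {i : 'I_k & 'I_(z i)}}| = (\sum_i z i)%N.
Proof. exact: (card_sbm_vertex z). Qed.

(* A coordinate is dropped when [y / b] is below [K] or [y] is a negligible part
   of the piece: the pair energy of a fixed number of vertices is then small. *)
Definition piece_profile (K kap b : R) (y : 'cV[R]_k) (i : 'I_k) : nat :=
  if (K * b <= y i 0) && (kap * norm1 y <= y i 0) then Num.truncn (y i 0 / b) else 0%N.

Lemma piece_profile_le K kap b y i : 0 < b -> nonneg y ->
  (piece_profile K kap b y i)%:R <= y i 0 / b.
Proof.
move=> b0 y0; have yb : 0 <= y i 0 / b by rewrite divr_ge0 // ltW.
by rewrite /piece_profile; case: ifP => // _; rewrite truncn_le.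
Qed.

(** Any subset of the profile has energy at most lam per vertex. A subset with fewer than [s0]
    vertices has every coordinate below rho y_i / b, because the coordinates kept are large, and its
    energy is at most rho lam per vertex. These are the two scales of [subset_sum_two_scales]. *)
Lemma pr_no_piece_profile (y : 'cV[R]_k) (U : {set V}) (m c : nat)
    (lam rho K kap b x1 x2 d : R) : let z := piece_profile K kap b y in
  nonneg y -> 0 < b -> 0 < rho -> 0 < K -> 0 < kap -> (0 < m)%N -> 0 < d ->
  (forall v : 'cV[R]_k, (forall i, 0 <= v i 0 <= y i 0) ->
     qform Q v <= 2 * lam * b * norm1 v) ->
  (forall i, m%:R * (y i 0 / b) <= #|U :&: block n i|%:R) ->
  c%:R <= rho * K -> x1 <= 1 / 2 -> x2 <= 1 / 2 ->
  norm1 y / b * expR (rho * lam) / m%:R <= x1 ->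
  expR 1 / (rho * kap) * expR lam / m%:R <= x2 ->
  2 * x1 ^+ 2 + 2 * x2 ^+ c <= d ->
  sbm_Pr P (fun G => ~~ has_profile G U z) <= expR (1 - (2 * d)^-1).
Proof.
move=> z y0 b0 rho0 K0 kap0 m0 d0 yQ Um cK x11 x21 hx1 hx2 hd.
have zy i : (z i)%:R <= y i 0 / b by apply: piece_profile_le.
have mR0 : 0 < m%:R :> R by rewrite ltr0n.
apply: (pr_no_profile P_sym P_itv m0 _ d0) => [i|].
  rewrite -(ler_nat R) natrM; apply: le_trans (Um i).
  by rewrite ler_wpM2l.
apply: le_trans hd.
set t := norm1 y / b.
have t0 : 0 <= t by rewrite divr_ge0 ?norm1_ge0 // ltW.
set T := #|{: {i : 'I_k & 'I_(z i)}}|.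
have Tt : T%:R <= t.
  rewrite /T card_profile_index natr_sum /t norm1_nonneg // mulr_suml.
  by apply: ler_sum => i _.
(* A kept coordinate satisfies y_i / b >= max (K, kap t). The part with K gives c <= s0; the part
   with kap t bounds e |A| / s0 by e / (rho kap). *)
pose s0 := rho * Num.max K (kap * t).
have s00 : 0 < s0 by rewrite mulr_gt0 // lt_max K0.
(* Scaling the profile of [I] by b / r puts it in the box of [y]; the form is quadratic and the norm
   linear, so scaling back gains the factor r. *)
have scaled (I : {set {i : 'I_k & 'I_(z i)}}) (r : R) : 0 < r ->
    (forall i, profile_vec I i 0 <= r * (y i 0 / b)) ->
    type_energy P tag I <= r * lam * #|I|%:R.
  move=> r0 hr; apply: le_trans (energy_profile_vec I) _.
  have br0 : 0 < b / r by rewrite divr_gt0.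
  have := yQ ((b / r) *: profile_vec I); rewrite qformZ (norm1Z _ (ltW br0)) norm1_profile_vec.
  set q := qform _ _; set s := #|I|%:R => h.
  have {}h : (b / r) ^+ 2 * q <= 2 * lam * b * (b / r * s).
    apply: h => i; rewrite mxE mulr_ge0 ?(ltW br0) ?profile_vec_nonneg //=.
    apply: le_trans (ler_wpM2l (ltW br0) (hr i)) _.
    rewrite le_eqVlt; apply/orP; left; apply/eqP.
    by rewrite (mulrA (b / r)) divfK ?gt_eqF // mulrCA mulfV ?mulr1 ?gt_eqF.
  have {}h : q <= r * (2 * lam * s).
    rewrite -(ler_pM2l (exprn_gt0 2 br0)); apply: le_trans h _.
    rewrite le_eqVlt; apply/orP; left; apply/eqP; rewrite expr2.
    have -> : 2 * lam * b * (b / r * s) = (b / r) * b * (2 * lam * s) by lra.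
    rewrite -[RHS]mulrA [in RHS](mulrA (b / r) r) divfK ?gt_eqF //.
    by rewrite -mulrA.
  lra.
apply: (@subset_sum_two_scales _ _ _ m c lam (rho * lam) s0) => //.
- by apply: le_trans cK _; rewrite /s0 ler_wpM2l ?(ltW rho0) // le_max lexx.
- move=> I; have := scaled I 1 ltr01; rewrite mul1r; apply => i.
  by rewrite mul1r; apply: le_trans (profile_vec_le _ _) (zy i).
- move=> I Is; apply: scaled => // i.
  have [z0|z0] := posnP (z i).
    apply: (@le_trans _ _ 0); last by rewrite mulr_ge0 ?divr_ge0 // ltW.
    by have := profile_vec_le I i; rewrite z0.
  apply: (@le_trans _ _ #|I|%:R); first by rewrite -norm1_profile_vec coord_le_norm1 //; apply: profile_vec_nonneg.
  apply: le_trans (ltW Is) _; rewrite ler_wpM2l ?(ltW rho0) // ge_max.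
  move: z0; rewrite /z /piece_profile; case: ifP => // /andP[h1 h2] _.
  by rewrite ler_pdivlMr // h1 /= /t mulrA ler_wpM2r // invr_ge0 ltW.
- apply: le_trans hx1; rewrite -/t ler_wpM2r ?invr_ge0 ?(ltW mR0) //.
  by rewrite ler_wpM2r ?expR_ge0.
- apply: le_trans hx2; rewrite ler_wpM2r ?invr_ge0 ?(ltW mR0) //.
  rewrite ler_wpM2r ?expR_ge0 // -mulrA ler_wpM2l ?expR_ge0 //.
  rewrite ler_pdivrMr // mulrC ler_pdivlMr ?mulr_gt0 // /s0.
  apply: (@le_trans _ _ (rho * kap * t)); first by rewrite mulrC ler_wpM2l // mulr_ge0 // ltW.
  by rewrite -mulrA ler_wpM2l ?(ltW rho0) // le_max lexx orbT.
Qed.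

Definition block_profile (i : 'I_k) (T : nat) (j : 'I_k) : nat := if j == i then T else 0%N.

(** Sets of at most t vertices inside one block have energy at most t q / 2 per vertex. For T = 1
    there are no pairs, and the sum over subsets is empty. *)
Lemma pr_no_block_profile (i : 'I_k) (U : {set V}) (T t : nat) (a q x d : R) :
  U \subset block n i -> (0 < T)%N -> (T <= t)%N -> (T <= #|U|)%N -> 0 < a ->
  ((1 < T)%N -> a * T%:R <= 2 * #|U|%:R) -> Q i i <= q -> 0 < d ->
  expR 1 * (4 * t%:R / a) * expR (t%:R * q / 2) <= x -> x <= 1 / 2 -> 4 * x ^+ 2 <= d ->
  sbm_Pr P (fun G => ~~ has_profile G U (block_profile i T)) <= expR (1 - (2 * d)^-1).
Proof.
move=> Ui T0 Tt TU a0 aT Qq d0 hx x12 xd; set z := block_profile i T.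
pose m := (#|U| %/ T)%N.
have m0 : (0 < m)%N by rewrite divn_gt0.
have mR0 : 0 < m%:R :> R by rewrite ltr0n.
apply: (pr_no_profile P_sym P_itv m0 _ d0) => [j|].
  rewrite /z /block_profile; case: eqP => [->|_]; last by rewrite muln0.
  by rewrite (setIidPl Ui) leq_trunc_div.
have cT : #|{: {i : 'I_k & 'I_(z i)}}| = T.
  rewrite card_profile_index (bigD1 i) //= /z /block_profile eqxx big1 ?addn0 //.
  by move=> j /negPf ->.
have [T1|T1] := leqP T 1.
  rewrite big1 ?(ltW d0) // => I I1.
  by have := leq_trans I1 (leq_trans (max_card _) (eq_leq cT)); rewrite ltnNge T1.
have TR0 : 0 < T%:R :> R by rewrite ltr0n.
have q0 : 0 <= q by apply: le_trans Qq; apply: logQ_ge0.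
have E (I : {set {i : 'I_k & 'I_(z i)}}) : type_energy P tag I <= t%:R * q / 2 * #|I|%:R.
  apply: le_trans (energy_profile_vec I) _.
  have vE : profile_vec I = #|I|%:R *: delta_mx i 0.
    have v0 j : j != i -> profile_vec I j 0 = 0.
      move=> ji; apply/eqP; rewrite eq_le profile_vec_nonneg andbT.
      by have := profile_vec_le I j; rewrite /z /block_profile (negPf ji).
    apply/matrixP => j l; rewrite ord1 [RHS]mxE [X in _ * X]mxE eqxx andbT.
    have [->|ji] := eqVneq j i; last by rewrite mulr0 v0.
    rewrite mulr1 -norm1_profile_vec norm1_nonneg; last exact: profile_vec_nonneg.
    by rewrite (bigD1 i) //= big1 ?addr0 // => j' /v0.
  have -> : qform Q (profile_vec I) = #|I|%:R ^+ 2 * Q i i.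
    rewrite vE qformZ; congr (_ * _); rewrite qformE (bigD1 i) //= (bigD1 i) //=.
    rewrite !big1 => [|j ji|j ji].
    - by rewrite !addr0 [X in X * _ * _]mxE [X in _ * _ * X]mxE !eqxx mul1r mulr1.
    - by rewrite big1 // => l _; rewrite [X in X * _ * _]mxE (negPf ji) !mul0r.
    - by rewrite [X in _ * _ * X]mxE (negPf ji) mulr0.
  have It : #|I|%:R <= t%:R :> R.
    rewrite ler_nat; apply: leq_trans Tt; apply: leq_trans (max_card _) _.
    by rewrite cT.
  have : #|I|%:R * Q i i <= t%:R * q by apply: ler_pM => //; apply: logQ_ge0.
  have : 0 <= #|I|%:R :> R by [].
  nra.
(* Rounding in [m] costs one factor 2, and the bound on [a * T] the other. *)
have Tm : T%:R / m%:R <= 4 * t%:R / a.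
  have mU : #|U|%:R <= 2 * (m%:R * T%:R) :> R.
    have h : (#|U| <= 2 * (m * T))%N.
      rewrite {1}(divn_eq #|U| T) -/m mul2n -addnn leq_add2l.
      apply: (@leq_trans T); first by rewrite ltnW // ltn_mod.
      by rewrite leq_pmull.
    by rewrite -natrM -(natrM _ 2) ler_nat.
  rewrite ler_pdivrMr // mulrAC ler_pdivlMr //.
  have := aT T1 => h.
  have h2 : a * T%:R <= 4 * m%:R * T%:R by lra.
  have {}h2 : a <= 4 * m%:R by rewrite -(ler_pM2r TR0).
  have Tt' : T%:R <= t%:R :> R by rewrite ler_nat.
  apply: (@le_trans _ _ (T%:R * (4 * m%:R))); first by rewrite ler_wpM2l // ltW.
  have : T%:R * m%:R <= t%:R * m%:R :> R by rewrite ler_wpM2r // ltW.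
  lra.
have e1 : 1 <= expR 1 :> R by rewrite ltW // expR_gt1.
set ee := expR (t%:R * q / 2) in hx *.
have ee0 : 0 <= ee by apply: expR_ge0.
have key : expR 1 * (T%:R / m%:R) * ee <= x.
  by apply: le_trans hx; rewrite ler_wpM2r // ler_wpM2l ?expR_ge0.
have Tm0 : 0 <= T%:R / m%:R * ee by rewrite !mulr_ge0 // invr_ge0 ltW.
(* One energy bound serves for all sizes, so both scales coincide and start at 2, giving 4 x^2. *)
apply: le_trans xd; apply: le_trans (subset_sum_two_scales (c := 2) (s0 := 2)
    (lam := t%:R * q / 2) (rho := t%:R * q / 2) m0 _ _ x12 x12 E (fun I _ => E I) _ _) _ => //.
- rewrite cT -/ee; apply: le_trans key; rewrite [leLHS]mulrAC -[leRHS]mulrA.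
  by rewrite ler_peMl.
- rewrite cT -/ee; apply: le_trans key.
  have -> : expR 1 * T%:R / 2 * ee / m%:R = 2^-1 * (expR 1 * (T%:R / m%:R * ee)) by lra.
  have : 0 <= expR 1 * (T%:R / m%:R * ee) by rewrite mulr_ge0 ?expR_ge0.
  by rewrite -mulrA; lra.
- lra.
Qed.

End Pieces.

(** * The greedy colouring and its failure event *)

Lemma card_set_type (T : finType) : #|{set T}| = (2 ^ #|T|)%N.
Proof. by rewrite -[#|T|]cardsT -card_powerset -cardsT powersetT. Qed.

Section Core.
Variables (R : realType) (k : nat) (n : 'I_k -> nat) (P : 'M[R]_k).
Hypothesis P_sym : forall i j, P i j = P j i.
Hypothesis P_itv : forall i j, 0 <= P i j < 1.
Local Notation V := (sbm_vertex n).
Local Notation Q := (logQ P).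
Local Notation nv := (size_vec R n).
Local Notation N := (norm1 nv).

Lemma norm1_size_vec : N = #|V|%:R.
Proof.
rewrite card_sbm_vertex natr_sum; apply: eq_bigr => i _.
by rewrite mxE normr_nat.
Qed.

(** [Y] is the system of pieces, and [b j] stands for w(Y_j) / (2 lam) raised to at least [b0]. The
    fraction [theta] of each block is held in reserve while the pieces are removed, [m] is the
    number of candidates per slot, and [t] and [a] fix the sizes of the sets used on the
    leftover. *)
Variables (Y : 'I_k -> 'cV[R]_k) (b : 'I_k -> R).
Hypothesis Y_ge0 : forall j, nonneg (Y j).
Hypothesis Y_sum : \sum_j Y j = nv.
Variables (lam rho K kap theta b0 a q x1 x2 x3 d : R) (m c t : nat).
Hypothesis b0_gt0 : 0 < b0.
Hypothesis b_ge : forall j, b0 <= b j.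
Hypothesis YQ : forall j (v : 'cV[R]_k), (forall i, 0 <= v i 0 <= Y j i 0) ->
  qform Q v <= 2 * lam * b j * norm1 v.
Hypotheses (rho_gt0 : 0 < rho) (K_ge1 : 1 <= K) (kap_gt0 : 0 < kap).
Hypotheses (theta_gt0 : 0 < theta) (theta_le1 : theta <= 1).
Hypotheses (m_gt0 : (0 < m)%N) (m_le : m%:R <= theta * b0) (c_le : c%:R <= rho * K).
Hypotheses (t_gt0 : (0 < t)%N) (a_ge2 : 2 <= a) (d_gt0 : 0 < d).
Hypothesis Q_le : forall i, Q i i <= q.
Hypotheses (x1_le : x1 <= 1 / 2) (x2_le : x2 <= 1 / 2) (x3_le : x3 <= 1 / 2).
Hypothesis x1P : N / b0 * expR (rho * lam) / m%:R <= x1.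
Hypothesis x2P : expR 1 / (rho * kap) * expR lam / m%:R <= x2.
Hypothesis x3P : expR 1 * (4 * t%:R / a) * expR (t%:R * q / 2) <= x3.
Hypotheses (d12 : 2 * x1 ^+ 2 + 2 * x2 ^+ c <= d) (d3 : 4 * x3 ^+ 2 <= d).

Hypothesis N_ge1 : 1 <= N.

Let z j := piece_profile K kap (b j) (Y j).
(** The successor makes the size positive and, below the cap [t], larger than u / a, as
    [colorable_on_greedy] requires. *)
Let T (u : nat) : nat := minn (Num.truncn (u%:R / a)).+1 t.
Let b_gt0 j : 0 < b j. Proof. exact: lt_le_trans (b_ge j). Qed.

Let Y_col i : \sum_j Y j i 0 = (n i)%:R.
Proof. by have := congr1 (fun M : 'cV_k => M i 0) Y_sum; rewrite summxE mxE. Qed.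

Let Y_le j i : Y j i 0 <= (n i)%:R.
Proof. by rewrite -Y_col (bigD1 j) //= lerDl; apply: sumr_ge0 => l _; apply: Y_ge0. Qed.

Let norm1_Y : \sum_j norm1 (Y j) = N.
Proof. by rewrite -norm1_sum // Y_sum. Qed.

Let norm1_Y_le j : norm1 (Y j) <= N.
Proof. by rewrite -norm1_Y (bigD1 j) //= lerDl; apply: sumr_ge0 => l _; apply: norm1_ge0. Qed.

(** The sets met by the greedy procedure depend on the graph, so failure is excluded for all sets
    [U] at once. The left summand concerns the pieces, the right one the leftover. *)
Definition bad_event (e : ('I_k * {set V}) + ('I_k * {set V})) (G : sgraph V) : bool :=
  match e with
  | inl (j, U) => [forall i, theta * (n i)%:R <= #|U :&: block n i|%:R] &&
      ~~ has_profile G U (z j)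
  | inr (i, U) => [&& U \subset block n i, U != set0 &
      ~~ has_profile G U (block_profile i (T #|U|))]
  end.

Lemma pr_bad_event e : sbm_Pr P (bad_event e) <= expR (1 - (2 * d)^-1).
Proof.
have false_le (A : pred (sgraph V)) : (forall G, A G = false) ->
    sbm_Pr P A <= expR (1 - (2 * d)^-1).
  by move=> A0; rewrite /sbm_Pr big_pred0 ?expR_ge0.
case: e => [[j U]|[i U]].
  have [/forallP hU|hU] := boolP [forall i, theta * (n i)%:R <= #|U :&: block n i|%:R]; last first.
    by apply: false_le => G; rewrite /= (negPf hU).
  apply: (@le_trans _ _ (sbm_Pr P (fun G => ~~ has_profile G U (z j)))).
    by apply: le_sbm_Pr => // G /andP[].
  have K0 : 0 < K := lt_le_trans ltr01 K_ge1.
  apply: (pr_no_piece_profile P_sym P_itv (Y_ge0 j) (b_gt0 j) rho_gt0 K0 kap_gt0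
    m_gt0 d_gt0 (YQ (j := j)) _ c_le x1_le x2_le _ x2P d12) => [i|].
    apply: le_trans (hU i); rewrite mulrCA mulrC.
    have mb : m%:R / b j <= theta.
      by rewrite ler_pdivrMr //; apply: le_trans m_le _; rewrite ler_wpM2l // ltW.
    by apply: ler_pM => //; [rewrite divr_ge0 // ltW | exact: Y_ge0].
  apply: le_trans x1P; rewrite ler_wpM2r ?invr_ge0 // ler_wpM2r ?expR_ge0 //.
  apply: ler_pM => //; first exact: norm1_ge0.
    by rewrite invr_ge0 ltW.
  by rewrite lef_pV2 ?posrE.
have [/andP[Ui U0]|hU] := boolP ((U \subset block n i) && (U != set0)); last first.
  by apply: false_le => G; rewrite /= andbA (negPf hU).
apply: (@le_trans _ _ (sbm_Pr P (fun G => ~~ has_profile G U (block_profile i (T #|U|))))).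
  by apply: le_sbm_Pr => // G /and3P[].
have a0 : 0 < a by apply: lt_le_trans a_ge2; rewrite ltr0n.
have U1 : 1 <= #|U|%:R :> R by rewrite ler1n card_gt0.
have ua0 : 0 <= #|U|%:R / a by rewrite divr_ge0 // ltW.
have aT : (1 < T #|U|)%N -> a * (T #|U|)%:R <= 2 * #|U|%:R.
  rewrite /T leq_min => /andP[T1 _].
  have ua1 : 1%:R <= #|U|%:R / a by rewrite -(truncn_ge_nat _ ua0).
  rewrite mulr1n in ua1.
  have : (T #|U|)%:R <= #|U|%:R / a + 1.
    apply: (@le_trans _ _ (Num.truncn (#|U|%:R / a)).+1%:R); first by rewrite ler_nat geq_minl.
    by rewrite -natr1 lerD2r truncn_le.
  rewrite -(ler_pM2l a0) mulrDr mulr1 mulrCA mulfV ?gt_eqF // mulr1 => h.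
  by rewrite ler_pdivlMr // mul1r in ua1; lra.
apply: (pr_no_block_profile P_sym P_itv Ui (T := T #|U|) (t := t) (a := a) (q := q) (x := x3)) => //.
- by rewrite leq_min t_gt0.
- exact: geq_minr.
- have [T1|T1] := leqP (T #|U|) 1; first by apply: leq_trans T1 _; rewrite card_gt0.
  rewrite -(ler_nat R); have := aT T1; have : 0 <= (T #|U|)%:R :> R by [].
  by have := a_ge2; nra.
Qed.

(** About [b j] sets of profile Y_j / b_j would exhaust the piece; stopping at the fraction 1 -
    theta keeps the reserve that [bad_event] asks for. *)
Let r j := Num.truncn ((1 - theta) * b j).

(** The terms account for the reserve, for a coordinate below K b_j or for rounding the profile (at
    most b_j), for rounding the number of sets (at most Y / b_j), and for a coordinate that is a
    negligible part of the piece. *)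
Lemma piece_leftover j i : Y j i 0 - (r j * z j i)%:R <=
  theta * Y j i 0 + K * b j + Y j i 0 / b0 + kap * norm1 (Y j).
Proof.
have bj := b_gt0 j; have y0 := Y_ge0 j i; have n0 := norm1_ge0 (Y j).
have kn : 0 <= kap * norm1 (Y j) by rewrite mulr_ge0 // ltW.
have yb : 0 <= Y j i 0 / b j by rewrite divr_ge0 // ltW.
have yb0 : Y j i 0 / b j <= Y j i 0 / b0 by rewrite ler_wpM2l // lef_pV2 ?posrE.
have ty : 0 <= theta * Y j i 0 by rewrite mulr_ge0 // ltW.
have Kb : 0 <= K * b j by rewrite mulr_ge0 ?(ltW bj) // (le_trans ler01 K_ge1).
rewrite /z /piece_profile; case: ifP => [_|/negbT]; last first.
  rewrite muln0 subr0 negb_and -!ltNge => /orP[h|h]; lra.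
have rb0 : 0 <= (1 - theta) * b j by rewrite mulr_ge0 ?subr_ge0 // ltW.
have /andP[r1 r2] := truncn_itv rb0; rewrite -/(r j) in r1 r2.
have /andP[z1 z2] := truncn_itv yb.
set s := Num.truncn (Y j i 0 / b j) in z1 z2 *.
rewrite natrM; rewrite -natr1 in r2; rewrite -natr1 in z2.
have yE : Y j i 0 / b j * b j = Y j i 0 by rewrite divfK // gt_eqF.
set u := Y j i 0 / b j in yb yb0 z1 z2 yE *.
set A := (1 - theta) * b j in r1 r2 rb0.
have key : A * u - (r j)%:R * s%:R <= A + u.
  have : 0 <= (r j)%:R :> R by []. have : 0 <= s%:R :> R by []. nra.
have AE : A * u = Y j i 0 - theta * Y j i 0 by rewrite -yE /A; lra.
have bK : b j <= K * b j by rewrite ler_peMl // ltW.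
have Ab : A <= b j by rewrite /A ler_piMl ?(ltW bj) // lerBlDr lerDl ltW.
lra.
Qed.

Let C := \sum_j b j.

(** The pieces use at most [C] colours. Summing [piece_leftover] over the pieces bounds the leftover
    of each block, and [colorable_on_greedy] colours it; the factor [k] arises since the blocks get
    disjoint palettes. *)
Lemma good_chromatic_number (G : sgraph V) :
  ~~ [exists e, bad_event e G] ->
  (chromatic_number G)%:R <=
    C + k%:R * ((K * C + (theta + b0^-1 + kap) * N) / t%:R + a * ln N + 1).
Proof.
rewrite negb_exists => /forallP good.
have a0 : 0 < a by apply: lt_le_trans a_ge2; rewrite ltr0n.
have tR0 : 0 < t%:R :> R by rewrite ltr0n.
have hz j (U : {set V}) : (forall i, theta * (n i)%:R <= #|U :&: block n i|%:R) ->
    has_profile G U (z j).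
  by move=> hU; have := good (inl (j, U)); rewrite /= negb_and negbK => /orP[/negP[]|//]; apply/forallP.
pose js := flatten [seq nseq (r j) j | j <- enum 'I_k].
have sum_js i : (\sum_(j <- js) z j i = \sum_j r j * z j i)%N.
  rewrite /js big_flatten big_map big_enum /=; apply: eq_bigr => j _.
  by rewrite big_nseq iter_addn_0 mulnC.
have size_js : (size js)%:R <= C.
  rewrite /js size_flatten /shape -map_comp sumnE big_map big_enum natr_sum.
  apply: ler_sum => j _ /=; rewrite size_nseq.
  have bj := b_gt0 j.
  have rb0 : 0 <= (1 - theta) * b j by rewrite mulr_ge0 ?subr_ge0 // ltW.
  apply: (@le_trans _ _ ((1 - theta) * b j)); first by rewrite truncn_le.
  by rewrite ler_piMl ?(ltW bj) // lerBlDr lerDl ltW.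
have rz i : (\sum_j r j * z j i)%:R <= (1 - theta) * (n i)%:R :> R.
  rewrite natr_sum -Y_col mulr_sumr; apply: ler_sum => j _; rewrite natrM.
  have bj := b_gt0 j.
  have rb0 : 0 <= (1 - theta) * b j by rewrite mulr_ge0 ?subr_ge0 // ltW.
  have -> : (1 - theta) * Y j i 0 = (1 - theta) * b j * (Y j i 0 / b j).
    by rewrite mulrACA [b j / _]mulrC mulrA divfK ?gt_eqF // mulrC mulrA.
  by apply: ler_pM => //; [rewrite truncn_le | apply: piece_profile_le].
have [|U' cU' col] := colorable_on_extract hz (js := js) (U := setT).
  by move=> i; rewrite setTI card_block sum_js; have := rz i; lra.
have leftover i : #|U' :&: block n i|%:R <= K * C + (theta + b0^-1 + kap) * N.
  have := cU' i; rewrite setTI card_block sum_js => /(congr1 (fun x : nat => x%:R : R)).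
  rewrite natrD => h.
  have -> : #|U' :&: block n i|%:R = \sum_j (Y j i 0 - (r j * z j i)%:R).
    by rewrite sumrB Y_col -natr_sum; lra.
  apply: (@le_trans _ _ (\sum_j (theta * Y j i 0 + K * b j + Y j i 0 / b0 + kap * norm1 (Y j)))).
    by apply: ler_sum => j _; apply: piece_leftover.
  rewrite !big_split /= -!mulr_sumr -mulr_suml Y_col norm1_Y -/C.
  have nN : (n i)%:R <= N.
    by have := @coord_le_norm1 R k nv i; rewrite mxE; apply => l; rewrite mxE.
  have : theta * (n i)%:R <= theta * N by rewrite ler_wpM2l // ltW.
  have : (n i)%:R / b0 <= b0^-1 * N by rewrite mulrC ler_wpM2l // invr_ge0 ltW.
  lra.
have colb i : exists2 ci, colorable_on G (U' :&: block n i) ci &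
    ci%:R <= (K * C + (theta + b0^-1 + kap) * N) / t%:R + a * ln N + 1.
  have [ne|e] := boolP (U' :&: block n i != set0); last first.
    move: e; rewrite negbK => /eqP e; exists 0%N; first by rewrite e; apply: colorable_on0.
    rewrite ler_wpDl // addr_ge0 ?divr_ge0 ?mulr_ge0 ?(ltW a0) ?ln_ge0 //.
    by apply: le_trans (leftover i).
  have [|ci colci /(_ ne) ciP] := @colorable_on_greedy _ G R (block n i) t%:R a tR0 a0 _
     (U' :&: block n i) (subsetIr _ _).
    move=> U Ui U0; have := good (inr (i, U)); rewrite /= Ui U0 /= negbK.
    move=> /existsP[S /and3P[SU indS /forallP/(_ i)]]; rewrite /block_profile eqxx.
    rewrite (setIidPl (subset_trans SU Ui)) => /eqP cS; exists S; split=> //.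
      by rewrite -card_gt0 cS leq_min t_gt0.
    rewrite cS /T /minn; case: ltnP => _; [right|left] => //.
    by rewrite mulrC -ler_pdivrMr // ltW // truncnS_gt.
  exists ci => //; apply: le_trans ciP _; rewrite lerD2r; apply: lerD.
    by rewrite ler_wpM2r ?invr_ge0 ?(ltW tR0).
  have cU0 : 0 < #|U' :&: block n i|%:R :> R by rewrite ltr0n card_gt0.
  rewrite ler_wpM2l ?(ltW a0) // ler_ln ?posrE ?(lt_le_trans ltr01 N_ge1) //.
  by rewrite norm1_size_vec ler_nat max_card.
have [ci ciP ci_le] := fin_all_exists2 colb.
have := chromatic_number_le (col _ (colorable_on_blocks ciP)).
rewrite -(ler_nat R) natrD => /le_trans; apply; rewrite addrC; apply: lerD => //.
have kE (x : R) : k%:R * x = \sum_(i < k) x by rewrite sumr_const card_ord mulr_natl.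
by rewrite natr_sum kE; apply: ler_sum => i _.
Qed.

Lemma pr_chromatic_number (B : R) :
  C + k%:R * ((K * C + (theta + b0^-1 + kap) * N) / t%:R + a * ln N + 1) <= B ->
  sbm_Pr P (fun G : sgraph V => B < (chromatic_number G)%:R)
    <= 2 * k%:R * 2 ^+ #|V| * expR (1 - (2 * d)^-1).
Proof.
move=> hB; apply: (@le_trans _ _ (sbm_Pr P (fun G => [exists e, bad_event e G]))).
  apply: le_sbm_Pr => // G; apply: contraTT => /good_chromatic_number hG.
  by rewrite -leNgt; apply: le_trans hG hB.
apply: le_trans (sbm_Pr_union P_itv pr_bad_event) _.
rewrite card_sum !card_prod !card_ord !card_set_type natrD natrM natrX.
by rewrite -mulr2n -[_ *+ 2]mulr_natl !mulrA.
Qed.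

End Core.

From mathcomp Require Import all_classical all_reals all_analysis.
Import numFieldNormedType.Exports.
Local Open Scope classical_set_scope.

(** * The weights w and w_* *)

Section WeightTheory.
Variables (R : realType) (k : nat) (Q : 'M[R]_k).
Hypothesis Q_ge0 : forall i j, 0 <= Q i j.
Implicit Types (x y : 'cV[R]_k) (c : R).

Lemma wratioZ c y : 0 <= c -> wratio (c *: y) Q = c * wratio y Q.
Proof.
rewrite /wratio -!/(qform Q _) qformZ le_eqVlt => /orP[/eqP <-|c0].
  by rewrite expr0n /= !mul0r.
rewrite norm1Z ?ltW // invfM expr2 -!mulrA; congr (_ * _).
by rewrite mulrCA mulVKf ?gt_eqF.
Qed.

Lemma qform_wratio y : nonneg y -> qform Q y = wratio y Q * norm1 y.
Proof.
move=> y0; rewrite /wratio -/(qform Q y); have [n0|n0] := eqVneq (norm1 y) 0; last first.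
  by rewrite mulfVK.
rewrite n0 mulr0; apply/eqP; rewrite eq_le qform_ge0 // andbT qformE.
rewrite big1 // => i _; rewrite big1 // => j _.
have -> : y i 0 = 0 by apply/eqP; rewrite eq_le y0 andbT -n0 coord_le_norm1.
by rewrite !mul0r.
Qed.

Lemma wratio_ge0 y : nonneg y -> 0 <= wratio y Q.
Proof. by move=> y0; rewrite divr_ge0 ?norm1_ge0 //; apply: qform_ge0. Qed.

Definition box x : set 'cV[R]_k := [set y : 'cV[R]_k | forall i, 0 <= y i 0 <= x i 0].

Lemma box_nonneg x y : box x y -> nonneg y.
Proof. by move=> yx i; have /andP[] := yx i. Qed.

Lemma has_ubound_wratio x : has_ubound [set wratio y Q | y in box x].
Proof.
exists (\sum_i \sum_j x i 0 * Q i j) => _ [y yx <-].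
have y0 := box_nonneg yx; rewrite /wratio -/(qform Q y).
have [n0|n0] := eqVneq (norm1 y) 0.
  rewrite n0 invr0 mulr0; apply: sumr_ge0 => i _; apply: sumr_ge0 => j _.
  by have /andP[a b] := yx i; rewrite mulr_ge0 // (le_trans a).
have n1 : 0 < norm1 y by rewrite lt_neqAle eq_sym n0 norm1_ge0.
rewrite ler_pdivrMr // qformE mulr_suml; apply: ler_sum => i _.
rewrite mulr_suml; apply: ler_sum => j _; have /andP[a b] := yx i.
by apply: ler_pM; rewrite ?mulr_ge0 ?ler_wpM2r // coord_le_norm1.
Qed.

Lemma wratio_le_w x y : box x y -> wratio y Q <= w x Q.
Proof.
move=> yx; apply: sup_upper_bound; last by exists y.
by split; [exists (wratio y Q), y|exact: has_ubound_wratio].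
Qed.

Lemma qform_le_w x y : box x y -> qform Q y <= w x Q * norm1 y.
Proof.
move=> yx; rewrite qform_wratio; last exact: box_nonneg yx.
by rewrite ler_wpM2r ?norm1_ge0 // wratio_le_w.
Qed.

Lemma box0 x : nonneg x -> box x 0.
Proof. by move=> x0 i; rewrite mxE lexx x0. Qed.

Lemma w_le x (b : R) : nonneg x -> (forall y, box x y -> wratio y Q <= b) -> w x Q <= b.
Proof.
move=> x0 h; apply: ge_sup; last by move=> _ [y yx <-]; apply: h.
by exists (wratio 0 Q), 0 => //; apply: box0.
Qed.

Lemma w_ge0 x : nonneg x -> 0 <= w x Q.
Proof. by move=> x0; apply: le_trans (wratio_le_w (box0 x0)); apply: wratio_ge0 => i; rewrite mxE. Qed.

Lemma wZ c x : 0 <= c -> nonneg x -> w (c *: x) Q <= c * w x Q.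
Proof.
move=> c0 x0; apply: w_le => [i|y yx]; first by rewrite mxE mulr_ge0.
move: c0; rewrite le_eqVlt => /orP[/eqP c0|c0].
  suff -> : y = 0 by rewrite /wratio mulmx0 mxE !mul0r -c0 mul0r.
  apply/matrixP => i j; rewrite ord1 mxE; apply/eqP; rewrite eq_le.
  by have := yx i; rewrite -c0 mxE mul0r andbC.
have yE : y = c *: (c^-1 *: y) by rewrite scalerA divff ?gt_eqF // scale1r.
rewrite {1}yE wratioZ ?(ltW c0) // ler_wpM2l ?(ltW c0) //; apply: wratio_le_w => i.
have /andP[a b] := yx i; rewrite !mxE in b *; rewrite ler_pdivrMl // b andbT.
by rewrite mulr_ge0 ?invr_ge0 //; apply: ltW.
Qed.

Lemma qform_delta c i : qform Q (c *: delta_mx i 0) = c ^+ 2 * Q i i.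
Proof.
rewrite qformZ qformE (bigD1 i) //= (bigD1 i) //= !mxE !eqxx mul1r mulr1 /=.
rewrite !big1 ?addr0 // => j ji.
  by rewrite big1 // => l _; rewrite !mxE (negPf ji) !mul0r.
by rewrite !mxE (negPf ji) mulr0.
Qed.

Lemma norm1_delta c i : 0 <= c -> norm1 (c *: delta_mx i 0 : 'cV[R]_k) = c.
Proof.
move=> c0; rewrite norm1Z // /norm1 (bigD1 i) //= !mxE !eqxx normr1 big1 ?addr0 ?mulr1 //.
by move=> j ji; rewrite !mxE (negPf ji) normr0.
Qed.

Lemma wratio_delta c i : 0 <= c -> wratio (c *: delta_mx i 0) Q = c * Q i i.
Proof.
move=> c0; rewrite /wratio -/(qform Q _) qform_delta norm1_delta //.
move: c0; rewrite le_eqVlt => /orP[/eqP <-|c0]; first by rewrite invr0 mulr0 mul0r.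
by rewrite expr2 mulrAC mulfK ?gt_eqF.
Qed.

Lemma diag_le_w x i : nonneg x -> x i 0 * Q i i <= w x Q.
Proof.
move=> x0; rewrite -wratio_delta //; apply: wratio_le_w => j; rewrite !mxE eqxx andbT.
by case: eqP => [->|_]; rewrite ?mulr1 ?mulr0 lexx x0.
Qed.

Lemma w_delta c i : 0 <= c -> w (c *: delta_mx i 0) Q <= c * Q i i.
Proof.
move=> c0; apply: w_le => [j|y yx]; first by rewrite !mxE mulr_ge0.
have -> : y = y i 0 *: delta_mx i 0.
  apply/matrixP => j l; rewrite ord1 !mxE eqxx andbT.
  case: (eqVneq j i) => [->|ji]; rewrite ?mulr1 // mulr0; apply/eqP.
  by have := yx j; rewrite !mxE (negPf ji) mulr0 eq_le andbC.
have := yx i; rewrite !mxE !eqxx mulr1 => /andP[y0 yc].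
by rewrite wratio_delta // ler_wpM2r.
Qed.

Lemma vec_system_sum x (J : finType) (Y : J -> 'cV[R]_k) :
  (forall j, nonneg (Y j)) -> \sum_j Y j = x -> vec_system x [seq Y j | j <- enum J].
Proof.
move=> Y0 Yx; split=> [y /mapP[j _ ->] i|]; first exact: Y0.
by rewrite big_map big_enum.
Qed.

Lemma wsum_ge0 (S : seq 'cV[R]_k) : (forall y, y \in S -> nonneg y) ->
  0 <= \sum_(y <- S) w y Q.
Proof. by move=> S0; rewrite big_seq sumr_ge0 // => y /S0 y0; apply: w_ge0. Qed.

Lemma has_inf_wstar x : nonneg x ->
  has_inf [set \sum_(y <- S) w y Q | S in vec_system x].
Proof.
move=> x0; split.
  exists (\sum_(y <- [:: x]) w y Q), [:: x] => //; split; last by rewrite big_seq1.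
  by move=> y; rewrite inE => /eqP ->.
by exists 0 => _ [S [S0 _] <-]; apply: wsum_ge0 => y /S0.
Qed.

(** Tested on the system that splits [x] into its coordinates. For the size vector the right side is
    qhat N, which converts the hypothesis on w_* into one on k q*. *)
Lemma wstar_le x : nonneg x -> wstar x Q <= \sum_i x i 0 * Q i i.
Proof.
move=> x0; pose Y i := x i 0 *: delta_mx i 0 : 'cV[R]_k.
apply: (@le_trans _ _ (\sum_(y <- [seq Y j | j <- enum 'I_k]) w y Q)).
  apply: ge_inf; first by have [] := has_inf_wstar x0.
  exists [seq Y j | j <- enum 'I_k] => //; apply: vec_system_sum => [j i|].
    by rewrite !mxE mulr_ge0.
  apply/matrixP => i l; rewrite ord1 summxE (bigD1 i) //= !mxE !eqxx mulr1 big1 ?addr0 //.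
  by move=> j ji; rewrite !mxE eq_sym (negPf ji) mulr0.
rewrite big_map big_enum /=; apply: ler_sum => i _; exact: w_delta.
Qed.

(** In any system, w(y) dominates each of the k terms y_i q_ii. This is the source of the lower
    bound N^(1 - sigma - o(1)) on w_*. *)
Lemma wstar_ge x : nonneg x -> \sum_i x i 0 * Q i i <= k%:R * wstar x Q.
Proof.
move=> x0; have [ne lb] := has_inf_wstar x0.
have h S : vec_system x S -> \sum_i x i 0 * Q i i <= k%:R * \sum_(y <- S) w y Q.
  move=> [S0 <-]; under eq_bigr => i _ do rewrite summxE mulr_suml.
  rewrite exchange_big /= mulr_sumr big_seq [leRHS]big_seq; apply: ler_sum => y yS.
  have -> : k%:R * w y Q = \sum_(i < k) w y Q by rewrite sumr_const card_ord mulr_natl.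
  by apply: ler_sum => i _; apply: diag_le_w => j; apply: S0.
have [k0|k0] := eqVneq (k%:R : R) 0.
  by have [_ [S Sx _]] := ne; have := h S Sx; rewrite k0 !mul0r.
have {}k0 : 0 < k%:R :> R by rewrite lt_neqAle eq_sym k0 ler0n.
rewrite -ler_pdivrMl //; apply: lb_le_inf => // _ [S Sx <-].
by rewrite ler_pdivrMl // h.
Qed.

(* A linear dependence between more than [k] vectors lets one of them be
   scaled down to [0] without increasing the total weight. *)
Lemma drop_vector l (Y : 'I_l.+1 -> 'cV[R]_k) : (k <= l)%N -> (forall j, nonneg (Y j)) ->
  exists Y' : 'I_l -> 'cV[R]_k, [/\ forall j, nonneg (Y' j),
    \sum_j Y' j = \sum_j Y j & \sum_j w (Y' j) Q <= \sum_j w (Y j) Q].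
Proof.
move=> kl Y0; pose A : 'M[R]_(l.+1, k) := \matrix_(i, j) Y i j 0.
have W0 j : 0 <= w (Y j) Q by apply: w_ge0.
have [u [uA [uW [j0 uj0]]]] : exists u : 'rV[R]_l.+1, u *m A = 0 /\
    0 <= \sum_j u 0 j * w (Y j) Q /\ exists j, 0 < u 0 j.
  have ker0 : kermx A != 0.
    rewrite kermx_eq0 /row_free; apply: contraTneq kl => rA.
    by rewrite -ltnNge; have := rank_leq_col A; rewrite rA.
  have [u uA u0] : exists2 u : 'rV[R]_l.+1, u *m A = 0 & u != 0.
    exists (nz_row (kermx A)); last by rewrite nz_row_eq0.
    by apply/sub_kermxP; apply: nz_row_sub.
  (* The sign of the dependence is chosen so that moving against it does not increase the total
     weight. *)
  wlog uW : u uA u0 / 0 <= \sum_j u 0 j * w (Y j) Q.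
    move=> wl; have [|neg] := leP 0 (\sum_j u 0 j * w (Y j) Q); first exact: wl.
    apply: (wl (- u)); rewrite ?mulNmx ?uA ?oppr0 ?oppr_eq0 //.
    under eq_bigr => j _ do rewrite mxE mulNr.
    by rewrite sumrN oppr_ge0 ltW.
  have [[j uj]|npos] := pselect (exists j, 0 < u 0 j); first by exists u; split=> //; split=> //; exists j.
  have le0 j : u 0 j <= 0 by rewrite leNgt; apply/negP => uj; apply: npos; exists j.
  exists (- u); rewrite mulNmx uA oppr0; split=> //; split.
    by apply: sumr_ge0 => j _; rewrite mxE mulr_ge0 // oppr_ge0.
  have /rV0Pn[j uj] := u0; exists j.
  by rewrite mxE oppr_gt0 lt_neqAle uj le0.
pose i0 := [arg max_(i > j0) u 0 i]%O.
have [ui0 umax] : 0 < u 0 i0 /\ forall i, u 0 i <= u 0 i0.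
  rewrite /i0; case: arg_maxP => // i _ imax; split=> [|i']; last exact: imax.
  by apply: lt_le_trans uj0 _; apply: imax.
(* The largest step against [u] that keeps all coefficients nonnegative; it annihilates the vector
   [i0]. *)
pose c i := 1 - u 0 i / u 0 i0.
have c0 i : 0 <= c i by rewrite subr_ge0 ler_pdivrMr // mul1r.
have ci0 : c i0 = 0 by rewrite /c divff ?gt_eqF // subrr.
exists (fun j => c (lift i0 j) *: Y (lift i0 j)); split.
- by move=> j i; rewrite mxE mulr_ge0 //; apply: Y0.
- have uY : \sum_i u 0 i *: Y i = 0.
    apply/matrixP => i l'; rewrite ord1 summxE [RHS]mxE.
    have uAi : (u *m A) 0 i = 0 by rewrite uA mxE.
    rewrite -[RHS]uAi [RHS]mxE.
    by apply: eq_bigr => j _; rewrite !mxE.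
  transitivity (\sum_i c i *: Y i).
    by rewrite [RHS](bigD1_ord i0) //= ci0 scale0r add0r.
  rewrite /c; under eq_bigr => i _ do rewrite scalerBl scale1r mulrC -scalerA.
  by rewrite sumrB -scaler_sumr uY scaler0 subr0.
- apply: (@le_trans _ _ (\sum_i c i * w (Y i) Q)).
    rewrite [leRHS](bigD1_ord i0) //= ci0 mul0r add0r; apply: ler_sum => j _.
    exact: wZ.
  rewrite /c; under eq_bigr => i _ do rewrite mulrBl mul1r mulrAC.
  by rewrite sumrB lerBlDr lerDl -mulr_suml mulr_ge0 // invr_ge0 ltW.
Qed.

Lemma w0 : w 0 Q <= 0.
Proof. by have := @wZ 0 0 (lexx _); rewrite scale0r mul0r; apply => i; rewrite mxE. Qed.

(** A long system is shortened by [drop_vector] until [k] vectors remain; a short one is padded with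
    zero vectors, which have no weight. *)
Lemma near_optimal_system x (e : R) : nonneg x -> 0 < e ->
  exists Y : 'I_k -> 'cV[R]_k, [/\ forall j, nonneg (Y j), \sum_j Y j = x &
    \sum_j w (Y j) Q <= wstar x Q + e].
Proof.
move=> x0 e0; have [_ [S [S0 Sx] <-] Se] := inf_adherent e0 (has_inf_wstar x0).
have {Se Sx x0 e0} : exists Y : 'I_(size S) -> 'cV[R]_k, [/\ forall j, nonneg (Y j), \sum_j Y j = x &
    \sum_j w (Y j) Q <= wstar x Q + e].
  exists (fun j => nth 0 S j); split=> [j i||].
  - by apply: S0; apply: mem_nth.
  - by rewrite -Sx (big_nth 0) big_mkord.
  - by apply: le_trans (ltW Se); rewrite [leRHS](big_nth 0) big_mkord.
move: (size S) => l {S S0}.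
have pad (l' : nat) : (l' <= k)%N -> (exists Y : 'I_l' -> 'cV[R]_k, [/\ forall j, nonneg (Y j),
    \sum_j Y j = x & \sum_j w (Y j) Q <= wstar x Q + e]) ->
    exists Y : 'I_k -> 'cV[R]_k, [/\ forall j, nonneg (Y j), \sum_j Y j = x &
    \sum_j w (Y j) Q <= wstar x Q + e].
  move=> lk [Y [Y0 Yx Ye]]; pose Z (i : nat) := oapp Y 0 (insub i : option 'I_l').
  have ZY (j : 'I_l') : Z j = Y j by rewrite /Z valK.
  have Zlk i : (l' <= i)%N -> Z i = 0 by move=> li; rewrite /Z insubF // ltnNge li.
  exists Z; split.
  - by move=> j; rewrite /Z; case: insub => [j'|] //= i; rewrite ?mxE //; apply: Y0.
  - rewrite -Yx -(eq_bigr _ (fun j _ => ZY j)) (big_ord_widen _ Z lk) [RHS]big_mkcond.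
    by apply: eq_bigr => j _; case: ltnP => // /Zlk.
  - apply: le_trans Ye; rewrite -(eq_bigr _ (fun j _ => congr1 (fun y => w y Q) (ZY j))).
    rewrite (big_ord_widen _ (fun j => w (Z j) Q) lk) [leRHS]big_mkcond.
    by apply: ler_sum => j _; case: ltnP => // /Zlk ->; exact: w0.
elim: l => [|l IH]; first exact: pad.
have [kl|lk] := leqP k l; last exact: pad.
move=> [Y [Y0 Yx Ye]]; have [Y' [Y'0 Y'x Y'e]] := drop_vector kl Y0.
by apply: IH; exists Y'; rewrite Y'x; split=> //; apply: le_trans Y'e Ye.
Qed.

End WeightTheory.

Lemma size_vec_nonneg (R : realType) k (n : 'I_k -> nat) : nonneg (size_vec R n).
Proof. by move=> i; rewrite mxE. Qed.

(** Pieces of very small weight would leave too few candidates per slot, so weights are raised to at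
    least [W0]; this adds at most k W0 to the total, next to the slack [e] of the near-optimal
    system. *)
Lemma pr_chromatic_number_wstar (R : realType) (k : nat) (n : 'I_k -> nat) (P : 'M[R]_k)
    (lam W0 e rho K kap theta a q x1 x2 x3 d B : R) (m c t : nat) :
  let Q := logQ P in let nv := size_vec R n in let N := norm1 nv in
  let b0 := W0 / (2 * lam) in
  let C := (wstar nv Q + e + k%:R * W0) / (2 * lam) in
  (forall i j, P i j = P j i) -> (forall i j, 0 <= P i j < 1) ->
  0 < lam -> 0 < W0 -> 0 < e -> 0 < rho -> 1 <= K -> 0 < kap -> 0 < theta <= 1 ->
  (0 < m)%N -> m%:R <= theta * b0 -> c%:R <= rho * K ->
  (0 < t)%N -> 2 <= a -> 0 < d -> (forall i, Q i i <= q) ->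
  x1 <= 1 / 2 -> x2 <= 1 / 2 -> x3 <= 1 / 2 ->
  N / b0 * expR (rho * lam) / m%:R <= x1 ->
  expR 1 / (rho * kap) * expR lam / m%:R <= x2 ->
  expR 1 * (4 * t%:R / a) * expR (t%:R * q / 2) <= x3 ->
  2 * x1 ^+ 2 + 2 * x2 ^+ c <= d -> 4 * x3 ^+ 2 <= d -> 1 <= N ->
  C + k%:R * ((K * C + (theta + b0^-1 + kap) * N) / t%:R + a * ln N + 1) <= B ->
  sbm_Pr P (fun G : sgraph (sbm_vertex n) => B < (chromatic_number G)%:R)
    <= 2 * k%:R * expR N * expR (1 - (2 * d)^-1).
Proof.
move=> Q nv N b0 C P_sym P_itv lam0 W00 e0 rho0 K1 kap0 /andP[th0 th1] m0 mb cK t0 a2 d0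
  Qq x11 x21 x31 hx1 hx2 hx3 d12 d3 N1 hB.
have Q0 i j : 0 <= Q i j by apply: logQ_ge0.
have [Y [Y0 Yn Yw]] := near_optimal_system Q0 (@size_vec_nonneg R k n) e0.
pose b j := Num.max (w (Y j) Q) W0 / (2 * lam).
have lam2 : 0 < 2 * lam by rewrite mulr_gt0.
have b00 : 0 < b0 by rewrite divr_gt0.
have b0b j : b0 <= b j by rewrite ler_wpM2r ?invr_ge0 ?(ltW lam2) // le_max lexx orbT.
have YQ j (v : 'cV[R]_k) : (forall i, 0 <= v i 0 <= Y j i 0) ->
    qform Q v <= 2 * lam * b j * norm1 v.
  move=> vY; apply: le_trans (qform_le_w Q0 vY) _.
  rewrite ler_wpM2r ?norm1_ge0 // /b mulrCA mulfV ?gt_eqF // mulr1.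
  by rewrite le_max lexx.
have bC : \sum_j b j <= C.
  rewrite -mulr_suml ler_wpM2r ?invr_ge0 ?(ltW lam2) //.
  apply: le_trans (lerD Yw (lexx _)).
  have -> : k%:R * W0 = \sum_(j < k) W0 by rewrite sumr_const card_ord mulr_natl.
  rewrite -big_split /=; apply: ler_sum => j _; rewrite ge_max lerDl (ltW W00) /=.
  by rewrite lerDr w_ge0.
have tR : 0 < t%:R :> R by rewrite ltr0n.
have K0 : 0 <= K by apply: le_trans K1.
have N0 : 0 <= N by apply: norm1_ge0.
apply: le_trans (pr_chromatic_number P_sym P_itv Y0 Yn b00 b0b YQ rho0 K1 kap0 th0 th1
  m0 mb cK t0 a2 d0 Qq x11 x21 x31 hx1 hx2 hx3 d12 d3 N1 (B := B) _) _.
  apply: le_trans hB; apply: lerD => //; rewrite ler_wpM2l // lerD2r lerD2r.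
  by rewrite ler_wpM2r ?invr_ge0 ?(ltW tR) // lerD2r ler_wpM2l.
rewrite ler_wpM2r ?expR_ge0 // ler_wpM2l //.
rewrite /N norm1_size_vec -[X in expR X]mulr1 expRM_natl lerXn2r ?nnegrE ?expR_ge0 //.
exact: expR_ge1Dx.
Qed.

(** * Choice of the parameters *)

Section Powers.
Variables (R : realType) (N : R).
Hypothesis N_ge1 : 1 <= N.

Lemma powRD1 x y : N `^ (x + y) = N `^ x * N `^ y.
Proof. by rewrite powRD //; apply/implyP => _; rewrite gt_eqF // (lt_le_trans ltr01 N_ge1). Qed.

Lemma le_powRM X Y x y s : 0 <= X -> X <= N `^ x -> 0 <= Y -> Y <= N `^ y ->
  x + y <= s -> X * Y <= N `^ s.
Proof.
move=> X0 Xx Y0 Yy xy; apply: (@le_trans _ _ (N `^ (x + y))); last exact: ler_powR.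
by rewrite powRD1 ler_pM.
Qed.

Lemma ge_powRM X Y x y s : N `^ x <= X -> N `^ y <= Y -> s <= x + y -> N `^ s <= X * Y.
Proof.
move=> Xx Yy xy; apply: (@le_trans _ _ (N `^ (x + y))); first exact: ler_powR.
by rewrite powRD1 ler_pM ?powR_ge0.
Qed.

Lemma le_powRV X x : N `^ x <= X -> X^-1 <= N `^ (- x).
Proof.
move=> h; have p0 : 0 < N `^ x by apply: powR_gt0; apply: lt_le_trans N_ge1.
by rewrite powRN lef_pV2 ?posrE // (lt_le_trans p0).
Qed.

Lemma ge_powRV X x : 0 < X -> X <= N `^ x -> N `^ (- x) <= X^-1.
Proof. by move=> X0 h; rewrite powRN lef_pV2 ?posrE // (lt_le_trans X0). Qed.

Lemma powR_ge1 x : 0 <= x -> 1 <= N `^ x.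
Proof. by move=> x0; rewrite -[leLHS](powRr0 N); apply: ler_powR. Qed.

Lemma powR_le1 x : x <= 0 -> N `^ x <= 1.
Proof. by move=> x0; rewrite -[leRHS](powRr0 N); apply: ler_powR. Qed.

End Powers.

Lemma truncn_ge_half (R : realType) (x : R) : 1 <= x -> x / 2 <= (Num.truncn x)%:R.
Proof.
move=> x1; have x0 : 0 <= x by lra.
have /andP[_ h] := truncn_itv x0; rewrite -natr1 in h.
have : (1 <= Num.truncn x)%N by rewrite truncn_ge_nat.
rewrite -(ler_nat R) mulr1n; lra.
Qed.

Section Exponents.
Variables (R : realType) (N h tau sigma : R).
Hypotheses (N_ge1 : 1 <= N) (L_ge1 : 1 <= ln N) (L_le : ln N <= N `^ tau).
Hypothesis exps : [/\ 0 < h, h <= 1 / 10, 0 <= sigma, 4 * sigma + 2 * h <= 1 & 10 * tau = h / 20].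
Hypothesis const_le : 20 * expR 1 / h <= N `^ tau.
Local Notation L := (ln N).

Ltac explra := case: exps => *; lra.

Let N_gt0 : 0 < N. Proof. exact: lt_le_trans N_ge1. Qed.
Let L_gt0 : 0 < L. Proof. exact: lt_le_trans L_ge1. Qed.
Let h_gt0 : 0 < h. Proof. by case: exps. Qed.
Let tau_gt0 : 0 < tau. Proof. explra. Qed.

Lemma powR1_N : N `^ 1 = N.
Proof. by rewrite powRr1 // ltW. Qed.

Lemma powR_N_gt0 x : 0 < N `^ x.
Proof. exact: powR_gt0. Qed.

Lemma expR_powR x : expR (x * L) = N `^ x.
Proof. by rewrite /powR gt_eqF. Qed.

Let inv_h_ge : 10 <= h^-1.
Proof.
have -> : 10 = (1 / 10)^-1 :> R by lra.
by rewrite lef_pV2 ?posrE //; explra.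
Qed.

Let e_ge2 : 2 <= expR 1 :> R.
Proof. by have := expR_ge1Dx (1 : R); lra. Qed.

Lemma const_powR (x : R) : x <= expR 1 -> 20 * x / h <= N `^ tau.
Proof.
move=> xe; apply: le_trans const_le; rewrite ler_wpM2r ?invr_ge0 ?(ltW h_gt0) //.
by rewrite ler_wpM2l.
Qed.

Lemma const20_powR : 20 <= N `^ tau.
Proof.
have h1 : (1 : R) <= expR 1 by apply: le_trans e_ge2; rewrite ler1n.
by apply: le_trans (const_powR h1); have := inv_h_ge; lra.
Qed.

Lemma const4e_powR : 4 * expR 1 <= N `^ tau.
Proof.
apply: le_trans const_le; rewrite mulrAC ler_wpM2r ?expR_ge0 //.
by have := inv_h_ge; lra.
Qed.

Lemma const_er_powR : expR 1 / (h / 10) <= N `^ tau.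
Proof.
apply: le_trans const_le; rewrite invfM invrK.
have : 0 <= expR 1 / h by rewrite divr_ge0 ?expR_ge0 // ltW.
lra.
Qed.

Lemma const_invh_powR : 20 / h <= N `^ tau.
Proof.
have h1 : (1 : R) <= expR 1 by apply: le_trans e_ge2; rewrite ler1n.
by apply: le_trans (const_powR h1); rewrite mulr1.
Qed.

Lemma invh_powR : h^-1 <= N `^ tau.
Proof. by apply: le_trans const_invh_powR; have := inv_h_ge; lra. Qed.

Lemma h_ge_powR : N `^ (- tau) <= h.
Proof. by rewrite -[leRHS]invrK; apply: ge_powRV; rewrite ?invr_gt0 // invh_powR. Qed.

Lemma L4_powR : 4 * L <= N `^ (2 * tau).
Proof.
apply: (le_powRM N_ge1 _ _ (ltW L_gt0) L_le (x := tau)) => //; last by lra.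
by have := const20_powR; lra.
Qed.

Lemma powR_le_half x : x <= - tau -> N `^ x <= 1 / 2.
Proof.
move=> xt; apply: (@le_trans _ _ (N `^ (- tau))); first exact: ler_powR.
have := const20_powR; rewrite powRN div1r lef_pV2 ?posrE ?powR_N_gt0 //; lra.
Qed.

Section ChosenValues.
(** [W0] is a factor N^(h / 20), that is N^(10 tau), below N^(1 - sigma), so that k W0 is negligible
    against w_*; [theta] is small enough for the reserve to be cheap, yet a power of N that costs
    [m] only N^(- h / 20). *)
Variables (d1 q lam W0 b0 theta : R) (m : nat).
Hypotheses (qE : q = N `^ (- sigma + d1)) (d1P : - tau <= d1 <= tau).
Hypotheses (lamE : lam = (1 - h) * ln (q * N)) (W0E : W0 = N `^ (1 - sigma - h / 20)).
Hypotheses (b0E : b0 = W0 / (2 * lam)) (thetaE : theta = N `^ (- (h / 20))).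
Hypothesis mE : m = Num.truncn (theta * b0).

Lemma ln_qN : ln (q * N) = (1 - sigma + d1) * L.
Proof.
rewrite qE -{2}powR1_N -powRD1 // ln_powR; congr (_ * _); lra.
Qed.

Lemma ln_qN_le : ln (q * N) <= (1 + tau) * L.
Proof. by rewrite ln_qN ler_wpM2r ?(ltW L_gt0) //; case/andP: d1P; explra. Qed.

Lemma ln_qN_gt0 : 0 < ln (q * N).
Proof. by rewrite ln_qN mulr_gt0 //; case/andP: d1P; explra. Qed.

Lemma ln_qN2_le : 2 * ln (q * N) <= 4 * L.
Proof.
have := ln_qN_le; have : tau * L <= 1 * L by rewrite ler_wpM2r ?(ltW L_gt0) //; explra.
lra.
Qed.

Lemma lam_gt0 : 0 < lam.
Proof. by rewrite lamE mulr_gt0 ?ln_qN_gt0 //; explra. Qed.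

Lemma lam_le : lam <= ln (q * N).
Proof. by rewrite lamE ler_piMl ?(ltW ln_qN_gt0) //; explra. Qed.

Lemma lam2_gt0 : 0 < 2 * lam.
Proof. by rewrite mulr_gt0 ?lam_gt0. Qed.

Lemma lam2_le : 2 * lam <= 4 * L.
Proof. by apply: le_trans ln_qN2_le; rewrite ler_wpM2l ?lam_le. Qed.

(** The factor 1 - h in [lam] takes about h (1 - sigma) >= 3 h / 4 off the exponent. This puts e^lam
    below [m], whose exponent is only slightly more than h / 10 short of 1 - sigma. *)
Lemma expR_lam_le : expR lam <= N `^ (1 - sigma - h / 2).
Proof.
rewrite -expR_powR ler_expR lamE ln_qN mulrA ler_wpM2r ?(ltW L_gt0) //.
case/andP: d1P => d1a d1b.
have e1 : h * (3 / 4 - tau) <= h * (1 - sigma + d1) by rewrite ler_wpM2l ?(ltW h_gt0) //; explra.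
have e2 : h * tau <= tau by rewrite ler_piMl ?(ltW tau_gt0) //; explra.
explra.
Qed.

Lemma expR_rho_lam_le : expR (h / 10 * lam) <= N `^ (h / 9).
Proof.
rewrite -expR_powR ler_expR.
apply: (@le_trans _ _ (h / 10 * ((1 + tau) * L))).
  rewrite ler_wpM2l ?divr_ge0 ?(ltW h_gt0) //.
  exact: le_trans lam_le ln_qN_le.
rewrite mulrA ler_wpM2r ?(ltW L_gt0) //.
have : h * tau <= h * (1 / 10) by rewrite ler_wpM2l ?(ltW h_gt0) //; explra.
explra.
Qed.

Lemma W0_gt0 : 0 < W0. Proof. by rewrite W0E powR_N_gt0. Qed.

Lemma W0_ge2 : 2 <= W0.
Proof.
apply: (@le_trans _ _ (N `^ tau)); first by have := const20_powR; lra.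
by rewrite W0E; apply: ler_powR => //; explra.
Qed.

Lemma b0_ge : N `^ (1 - sigma - h / 20 - 2 * tau) <= b0.
Proof.
rewrite b0E; apply: (@ge_powRM _ _ N_ge1 _ _ (1 - sigma - h / 20) (- (2 * tau))) => //.
  by rewrite W0E.
by apply: ge_powRV; [exact: lam2_gt0 | exact: le_trans lam2_le L4_powR].
Qed.

Lemma b0_gt0 : 0 < b0.
Proof. by rewrite b0E divr_gt0 ?W0_gt0 ?lam2_gt0. Qed.

Lemma theta_gt0 : 0 < theta. Proof. by rewrite thetaE powR_N_gt0. Qed.

Lemma theta_le1 : theta <= 1.
Proof. by rewrite thetaE; apply: powR_le1 => //; explra. Qed.

Lemma theta_b0_ge : N `^ (1 - sigma - h / 10 - 2 * tau) <= theta * b0.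
Proof.
apply: (@ge_powRM _ _ N_ge1 _ _ (- (h / 20)) (1 - sigma - h / 20 - 2 * tau)).
- by rewrite thetaE.
- exact: b0_ge.
- lra.
Qed.

Lemma theta_b0_ge1 : 1 <= theta * b0.
Proof. by apply: le_trans theta_b0_ge; apply: powR_ge1 => //; explra. Qed.

Lemma group_size_le : m%:R <= theta * b0.
Proof. by rewrite mE truncn_le (le_trans ler01) ?theta_b0_ge1. Qed.

Lemma group_size_ge : N `^ (1 - sigma - h / 10 - 3 * tau) <= m%:R.
Proof.
rewrite mE; apply: le_trans (truncn_ge_half theta_b0_ge1).
apply: (@ge_powRM _ _ N_ge1 _ _ (1 - sigma - h / 10 - 2 * tau) (- tau)).
- exact: theta_b0_ge.
- by apply: ge_powRV => //; have := const20_powR; lra.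
- lra.
Qed.

Lemma group_sizeR_gt0 : 0 < m%:R :> R.
Proof. by apply: lt_le_trans group_size_ge; apply: powR_N_gt0. Qed.

Lemma group_size_gt0 : (0 < m)%N.
Proof. by have := group_sizeR_gt0; rewrite ltr0n. Qed.

(** The ratio of profile size N^sigma to candidates N^(1 - sigma), up to the loss; its square yields
    the exponent 2 - 4 sigma. *)
Let x1 := N `^ (- 1 + 2 * sigma + h / 3).

Lemma small_sum_le_half : x1 <= 1 / 2.
Proof. by apply: powR_le_half; explra. Qed.

Lemma large_sum_le_half : N `^ (- (h / 4)) <= 1 / 2.
Proof. by apply: powR_le_half; explra. Qed.

Lemma piece_small_sum_le : N / b0 * expR (h / 10 * lam) / m%:R <= x1.
Proof.
have Nb : 0 <= N / b0 by rewrite divr_ge0 ?(ltW N_gt0) ?(ltW b0_gt0).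
have a1 : N / b0 <= N `^ (sigma + h / 20 + 2 * tau).
  apply: (@le_powRM _ _ N_ge1 _ _ 1 (- (1 - sigma - h / 20 - 2 * tau))).
  - exact: ltW.
  - by rewrite powR1_N.
  - by rewrite invr_ge0 ltW ?b0_gt0.
  - exact: le_powRV b0_ge.
  - lra.
have a2 : N / b0 * expR (h / 10 * lam) <= N `^ (sigma + h / 20 + 2 * tau + h / 9).
  exact: (le_powRM N_ge1 Nb a1 (expR_ge0 _) expR_rho_lam_le).
apply: (@le_powRM _ _ N_ge1 _ _ (sigma + h / 20 + 2 * tau + h / 9)
   (- (1 - sigma - h / 10 - 3 * tau)) _ _ a2).
- by rewrite mulr_ge0 ?expR_ge0.
- by rewrite invr_ge0 ltW ?group_sizeR_gt0.
- exact: le_powRV group_size_ge.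
- explra.
Qed.

Lemma piece_large_sum_le : expR 1 / (h / 10 * theta) * expR lam / m%:R <= N `^ (- (h / 4)).
Proof.
have h10 : 0 <= h / 10 by rewrite divr_ge0 ?(ltW h_gt0).
have a0 : 0 <= expR 1 / (h / 10 * theta).
  by rewrite divr_ge0 ?expR_ge0 // mulr_ge0 // ltW ?theta_gt0.
have a1 : expR 1 / (h / 10 * theta) <= N `^ (tau + h / 20).
  rewrite invfM mulrA; apply: (@le_powRM _ _ N_ge1 _ _ tau (h / 20)) => //.
  - by rewrite divr_ge0 ?expR_ge0.
  - exact: const_er_powR.
  - by rewrite invr_ge0 ltW ?theta_gt0.
  - by rewrite thetaE powRN invrK.
have a2 : expR 1 / (h / 10 * theta) * expR lam <= N `^ (tau + h / 20 + (1 - sigma - h / 2)).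
  exact: (le_powRM N_ge1 a0 a1 (expR_ge0 _) expR_lam_le).
apply: (@le_powRM _ _ N_ge1 _ _ (tau + h / 20 + (1 - sigma - h / 2))
   (- (1 - sigma - h / 10 - 3 * tau)) _ _ a2).
- by rewrite mulr_ge0 ?expR_ge0.
- by rewrite invr_ge0 ltW ?group_sizeR_gt0.
- exact: le_powRV group_size_ge.
- explra.
Qed.

Lemma q_gt0 : 0 < q. Proof. by rewrite qE powR_N_gt0. Qed.

Let d := N `^ (- 2 + 4 * sigma + h).
Let d' := N `^ (- 2 + 4 * sigma + 2 * h / 3).

Lemma x1_sqr : x1 ^+ 2 = d'.
Proof. by rewrite expr2 /x1 -powRD1 //; congr (_ `^ _); lra. Qed.

Lemma four_sqr_le_d : 4 * d' <= d.
Proof.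
apply: (@le_powRM _ _ N_ge1 _ _ tau (- 2 + 4 * sigma + 2 * h / 3)) => //.
- by have := const20_powR; lra.
- exact: powR_ge0.
- explra.
Qed.

Lemma block_sums_le_d : 4 * x1 ^+ 2 <= d.
Proof. by rewrite x1_sqr four_sqr_le_d. Qed.

(** Large intersections gain only N^(- h / 4) per vertex; 8 / h vertices bring this to N^(- 2),
    which is below x1^2. *)
Lemma piece_sums_le_d (c : nat) : 8 / h <= c%:R -> 2 * x1 ^+ 2 + 2 * N `^ (- (h / 4)) ^+ c <= d.
Proof.
move=> c8; have x2c : N `^ (- (h / 4)) ^+ c <= d'.
  rewrite -powR_mulrn ?powR_ge0 // -powRrM; apply: ler_powR => //.
  have e1 : h / 4 * (8 / h) <= h / 4 * c%:R by rewrite ler_wpM2l // divr_ge0 ?(ltW h_gt0).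
  have e2 : h / 4 * (8 / h) = 2.
    have -> : h / 4 * (8 / h) = 2 * (h * h^-1) by lra.
    by rewrite mulfV ?mulr1 ?gt_eqF.
  explra.
by have := four_sqr_le_d; rewrite x1_sqr; lra.
Qed.

(** With t about h ln N / (10 q), the energy factor e^(t q / 2) is at most N^(h / 20). The bound on
    k q K makes [t] large compared with k K. *)
Variables (K : R) (k t : nat).
Hypotheses (k_ge1 : 1 <= k%:R :> R) (k_le : k%:R <= N `^ tau) (K_ge1 : 1 <= K).
Hypothesis kq : k%:R * q * (2 * K) <= h * (h / 10) * L.
Hypothesis tE : t = Num.truncn (h / 10 * L / q).

Let hL_gt0 : 0 < h / 10 * L.
Proof. by rewrite !mulr_gt0 ?invr_gt0. Qed.

Lemma block_set_size_arg_ge1 : 1 <= h / 10 * L / q.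
Proof.
have q0 := q_gt0; rewrite ler_pdivlMr // mul1r.
have e1 : q <= k%:R * q by rewrite ler_peMl // ltW.
have e2 : k%:R * q * 1 <= k%:R * q * (2 * K).
  by rewrite ler_wpM2l ?mulr_ge0 ?(ltW q0) //; have := K_ge1; lra.
have e3 : h * (h / 10 * L) <= 1 * (h / 10 * L) by rewrite ler_wpM2r ?(ltW hL_gt0) //; explra.
by have := kq; lra.
Qed.

Lemma block_set_size_ge : h / 10 * L / q / 2 <= t%:R.
Proof. by rewrite tE; apply: truncn_ge_half block_set_size_arg_ge1. Qed.

Lemma block_set_size_gt0 : 0 < t%:R :> R.
Proof. by have := block_set_size_arg_ge1; have := block_set_size_ge; lra. Qed.

Lemma block_set_size_le : t%:R <= h / 10 * L / q.
Proof. by rewrite tE truncn_le (le_trans ler01 block_set_size_arg_ge1). Qed.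

Lemma inv_q_le : q^-1 <= N `^ (sigma + tau).
Proof. by rewrite qE -powRN; apply: ler_powR => //; case/andP: d1P; lra. Qed.

Lemma inv_q_ge : N `^ (sigma - tau) <= q^-1.
Proof. by rewrite qE -powRN; apply: ler_powR => //; case/andP: d1P; lra. Qed.

Let inv_q_ge0 : 0 <= q^-1.
Proof. by rewrite invr_ge0 ltW ?q_gt0. Qed.

Lemma block_sum_le : expR 1 * (4 * t%:R / W0) * expR (t%:R * q / 2) <= x1.
Proof.
have b1 : t%:R <= N `^ (sigma + 2 * tau).
  apply: le_trans block_set_size_le _; apply: (@le_powRM _ _ N_ge1 _ _ tau (sigma + tau)) => //.
  - exact: ltW.
  - by apply: le_trans L_le; rewrite ler_piMl ?(ltW L_gt0) //; explra.
  - exact: inv_q_le.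
  - lra.
have b2 : expR (t%:R * q / 2) <= N `^ (h / 20).
  rewrite -expR_powR ler_expR.
  have : t%:R * q <= h / 10 * L by rewrite -ler_pdivlMr ?q_gt0 ?block_set_size_le.
  lra.
have e4 : 0 <= 4 * expR 1 :> R by rewrite mulr_ge0 ?expR_ge0.
have b3 : 4 * expR 1 * t%:R <= N `^ (tau + (sigma + 2 * tau)).
  exact: (le_powRM N_ge1 e4 const4e_powR (ler0n _ _) b1).
have e5 : 0 <= 4 * expR 1 * t%:R :> R by rewrite mulr_ge0.
have b4 : 4 * expR 1 * t%:R / W0 <= N `^ (tau + (sigma + 2 * tau) - (1 - sigma - h / 20)).
  apply: (le_powRM N_ge1 e5 b3 _ _ (lexx _)); first by rewrite invr_ge0 ltW ?W0_gt0.
  by apply: le_powRV => //; rewrite W0E.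
have -> : expR 1 * (4 * t%:R / W0) = 4 * expR 1 * t%:R / W0 by lra.
apply: (le_powRM N_ge1 _ b4 (expR_ge0 _) b2); last by explra.
by rewrite divr_ge0 ?(ltW W0_gt0).
Qed.

Variable ws : R.
Hypothesis ws_ge : N `^ (1 - sigma - 2 * tau) <= ws.
Let X := ws / (2 * ln (q * N)).
Let C := (ws + h * ws + k%:R * W0) / (2 * lam).

Let ws_gt0 : 0 < ws.
Proof. by apply: lt_le_trans ws_ge; apply: powR_N_gt0. Qed.

Let ln2_gt0 : 0 < 2 * ln (q * N).
Proof. by rewrite mulr_gt0 ?ln_qN_gt0. Qed.

Let X_gt0 : 0 < X.
Proof. by rewrite divr_gt0. Qed.

Let k_ge0 : 0 <= k%:R :> R. Proof. by []. Qed.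

Lemma color_target_ge : N `^ (1 - sigma - 4 * tau) <= X.
Proof.
apply: (ge_powRM N_ge1 ws_ge (y := - (2 * tau))); last by lra.
by apply: ge_powRV => //; apply: le_trans ln_qN2_le L4_powR.
Qed.

Lemma h_color_target_ge : N `^ (1 - sigma - 5 * tau) <= h * X.
Proof. by apply: (ge_powRM N_ge1 h_ge_powR color_target_ge); lra. Qed.

Lemma kW0_le : k%:R * W0 <= h * ws.
Proof.
apply: (@le_trans _ _ (N `^ (1 - sigma - 3 * tau))).
  apply: (le_powRM N_ge1 k_ge0 k_le (ltW W0_gt0) (y := 1 - sigma - h / 20)).
    by rewrite W0E.
  explra.
by apply: (ge_powRM N_ge1 h_ge_powR ws_ge); lra.
Qed.

Lemma piece_colors_ge0 : 0 <= C.
Proof.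
by rewrite divr_ge0 ?(ltW lam2_gt0) // !addr_ge0 ?mulr_ge0 ?(ltW ws_gt0) ?(ltW h_gt0) ?(ltW W0_gt0).
Qed.

(** The slack and k W0 each add at most h w_*, and [lam] loses a factor 1 - h; (1 + 2 h) / (1 - h)
    <= 1 + 4 h for h <= 1 / 10. *)
Lemma piece_colors_le : C <= (1 + 4 * h) * X.
Proof.
rewrite ler_pdivrMr ?lam2_gt0 //.
have -> : (1 + 4 * h) * X * (2 * lam) = (1 + 4 * h) * (1 - h) * (X * (2 * ln (q * N))).
  by rewrite lamE; lra.
rewrite /X divfK ?gt_eqF //.
have hh : h * h <= h * (1 / 10) by rewrite ler_wpM2l ?(ltW h_gt0) //; explra.
have : (1 + 2 * h) * ws <= (1 + 4 * h) * (1 - h) * ws by rewrite ler_wpM2r ?(ltW ws_gt0) //; explra.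
by have := kW0_le; lra.
Qed.

(** This bounds the cost of the dropped coordinates: K C vertices in each of k blocks, coloured with
    sets of size t, take at most h C colours. *)
Lemma ktK_le : k%:R / t%:R * K <= h.
Proof.
rewrite mulrAC ler_pdivrMr ?block_set_size_gt0 //; apply: (@le_trans _ _ (h * (h / 10 * L / q / 2))); last first.
  by rewrite ler_wpM2l ?(ltW h_gt0) ?block_set_size_ge.
rewrite -(ler_pM2r q_gt0).
have -> : h * (h / 10 * L / q / 2) * q = h * (h / 10 * L) / 2 * (q^-1 * q) by lra.
by rewrite mulVf ?gt_eqF ?q_gt0 // mulr1; have := kq; lra.
Qed.

Lemma inv_t_le : t%:R^-1 <= N `^ (- sigma + 2 * tau).
Proof.
have -> : - sigma + 2 * tau = - (sigma - 2 * tau) by lra.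
apply: le_powRV => //; apply: le_trans block_set_size_ge.
have -> : h / 10 * L / q / 2 = (h / 20) * L * q^-1 by lra.
apply: (ge_powRM N_ge1 (x := - tau) _ inv_q_ge); last by lra.
have h20 : 0 < h / 20 by rewrite divr_gt0.
apply: (@le_trans _ _ (h / 20)); last by rewrite ler_peMr ?(ltW h20).
rewrite -[leRHS]invrK; apply: ge_powRV; first by rewrite invr_gt0.
by apply: le_trans const_invh_powR; rewrite invf_div.
Qed.

Let inv_t_ge0 : 0 <= t%:R^-1 :> R.
Proof. by rewrite invr_ge0 ltW ?block_set_size_gt0. Qed.

Let sum_ge0 : 0 <= theta + b0^-1 + theta.
Proof. by rewrite !addr_ge0 ?invr_ge0 ?(ltW theta_gt0) ?(ltW b0_gt0). Qed.

(** N / t has the same order as the target up to powers N^tau, so the factor [theta] = N^(- 10 tau)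
    decides. *)
Lemma leftover_le : k%:R * ((theta + b0^-1 + theta) * N / t%:R) <= h * X.
Proof.
apply: le_trans h_color_target_ge.
have e1 : theta + b0^-1 + theta <= N `^ (tau - h / 20).
  apply: (@le_trans _ _ (3 * theta)).
    suff : b0^-1 <= theta by lra.
    apply: le_trans (le_powRV N_ge1 b0_ge) _; rewrite thetaE; apply: ler_powR => //.
    explra.
  apply: (le_powRM N_ge1 (x := tau) _ _ (ltW theta_gt0) (y := - (h / 20))) => //.
  - by have := const20_powR; lra.
  - by rewrite thetaE.
have e2 : (theta + b0^-1 + theta) * N <= N `^ (tau - h / 20 + 1).
  by apply: (le_powRM N_ge1 sum_ge0 e1 (ltW N_gt0) _ (lexx _)); rewrite powR1_N.
have e3 : 0 <= (theta + b0^-1 + theta) * N by rewrite mulr_ge0 // ltW.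
have e4 : (theta + b0^-1 + theta) * N / t%:R <= N `^ (tau - h / 20 + 1 + (- sigma + 2 * tau)).
  exact: (le_powRM N_ge1 e3 e2 inv_t_ge0 inv_t_le).
by apply: (le_powRM N_ge1 k_ge0 k_le _ e4); [rewrite mulr_ge0 | explra].
Qed.

Lemma small_sets_le : k%:R * (W0 * L + 1) <= h * X.
Proof.
apply: le_trans h_color_target_ge.
have e1 : W0 * L + 1 <= N `^ (1 - sigma - h / 20 + 2 * tau).
  apply: (@le_trans _ _ (W0 * (4 * L))).
    have : 1 * 1 <= W0 * L.
      by apply: ler_pM => //; apply: le_trans W0_ge2; rewrite ler1n.
    lra.
  apply: (le_powRM N_ge1 (ltW W0_gt0) _ _ L4_powR (lexx _)); first by rewrite W0E.
  by rewrite mulr_ge0 // ltW.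
apply: (le_powRM N_ge1 k_ge0 k_le _ e1); last by explra.
by rewrite addr_ge0 // mulr_ge0 ?(ltW W0_gt0) // ltW.
Qed.

Lemma total_colors_le (eps : R) : 8 * h <= eps ->
  C + k%:R * ((K * C + (theta + b0^-1 + theta) * N) / t%:R + W0 * L + 1) <= (1 + eps) * X.
Proof.
move=> heps.
have -> : C + k%:R * ((K * C + (theta + b0^-1 + theta) * N) / t%:R + W0 * L + 1) =
   C + (k%:R / t%:R * K) * C + k%:R * ((theta + b0^-1 + theta) * N / t%:R) +
   k%:R * (W0 * L + 1) by lra.
have s1 : k%:R / t%:R * K * C <= h * C by rewrite ler_wpM2r ?piece_colors_ge0 ?ktK_le.
have s2 : (1 + h) * C <= (1 + h) * ((1 + 4 * h) * X).
  by rewrite ler_wpM2l ?piece_colors_le // addr_ge0 // ltW.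
have hh : h * h <= h * (1 / 10) by rewrite ler_wpM2l ?(ltW h_gt0) //; explra.
(* The factor 1 + h is for dropped coordinates, 1 + 4 h for the pieces, and 2 h for the remaining
   leftover and the small sets. *)
have s3 : (1 + h) * (1 + 4 * h) + 2 * h <= 1 + eps by explra.
have s4 : ((1 + h) * (1 + 4 * h) + 2 * h) * X <= (1 + eps) * X by rewrite ler_wpM2r ?(ltW X_gt0).
by have := leftover_le; have := small_sets_le; lra.
Qed.

(** With Z = N^(2 - 4 sigma - 2 h) >= N, the union bound costs at most e^(3 N) and Janson's
    inequality gives 1 / (2 d) >= 5 Z, because [d] holds back a further factor N^h. *)
Lemma union_bound_le : 2 * k%:R * expR N * expR (1 - (2 * d)^-1) <=
  expR (- (N `^ (2 - 4 * sigma - 2 * h))).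
Proof.
have kN : 2 * k%:R <= expR (2 * N).
  have : k%:R <= N.
    by apply: le_trans k_le _; rewrite -[leRHS]powR1_N; apply: ler_powR => //; explra.
  by have := expR_ge1Dx (2 * N); lra.
apply: (@le_trans _ _ (expR (2 * N) * expR N * expR (1 - (2 * d)^-1))).
  by rewrite ler_wpM2r ?expR_ge0 // ler_wpM2r ?expR_ge0.
rewrite -!expRD ler_expR.
set Z := N `^ _.
have NZ : N <= Z by rewrite -[leLHS]powR1_N; apply: ler_powR => //; explra.
have dZ : 10 * Z <= d^-1.
  rewrite /d -powRN; apply: (le_powRM N_ge1 (x := tau) _ _ (powR_ge0 _ _) (lexx Z)) => //.
    by have := const20_powR; lra.
  explra.
by rewrite invfM; have := N_ge1; lra.
Qed.

End ChosenValues.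
End Exponents.

(** The bound with a fixed loss [h]. Here rho = h / 10, and [K] is c / rho for the integer c just
    above 8 / h, the number of vertices from which the large scale is small enough. *)
Lemma pr_chromatic_number_powers (R : realType) (eps h tau sigma d1 d2 d3 : R)
    (k : nat) (n : 'I_k -> nat) (P : 'M[R]_k) :
  let Q := logQ P in let nv := size_vec R n in let N := norm1 nv in
  let K := (Num.truncn (8 / h)).+1%:R / (h / 10) in
  (forall i j, P i j = P j i) -> (forall i j, 0 <= P i j < 1) ->
  [/\ 0 < h, h <= 1 / 10, 0 <= sigma, 4 * sigma + 2 * h <= 1 & 10 * tau = h / 20] ->
  8 * h <= eps ->
  1 <= N -> 1 <= ln N -> ln N <= N `^ tau -> 20 * expR 1 / h <= N `^ tau ->
  - tau <= d1 <= tau -> - tau <= d2 <= tau -> - tau <= d3 <= tau ->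
  qstar Q = N `^ (- sigma + d1) -> qhat nv Q = N `^ (- sigma + d2) -> k%:R = N `^ d3 ->
  k%:R * qstar Q * (2 * K) <= h * (h / 10) * ln N ->
  sbm_Pr P (fun G : sgraph (sbm_vertex n) =>
      (1 + eps) * (wstar nv Q / (2 * ln (qstar Q * N))) < (chromatic_number G)%:R)
    <= expR (- (N `^ (2 - 4 * sigma - 2 * h))).
Proof.
move=> Q nv N K P_sym P_itv exps heps N1 L1 Ltau Ctau d1P d2P d3P qE qhE kE kq.
have [h0 h1 s0 sh tauE] := exps.
have N0 : 0 < N by apply: lt_le_trans N1.
have k1 : 1 <= k%:R :> R by rewrite ler1n -(ltr0n R) kE powR_gt0.
have kt : k%:R <= N `^ tau by rewrite kE; case/andP: d3P => _ ?; apply: ler_powR.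
have h10 : 0 < h / 10 by rewrite divr_gt0.
have K1 : 1 <= K.
  rewrite ler_pdivlMr // mul1r; apply: (@le_trans _ _ 1); first by lra.
  by rewrite ler1n.
have Q0 i j : 0 <= Q i j by apply: logQ_ge0.
have Qq i : Q i i <= qstar Q by apply: (le_bigmax _ (fun i => Q i i)).
have ws_ge : N `^ (1 - sigma - 2 * tau) <= wstar nv Q.
  have qhN : qhat nv Q * N = \sum_i nv i 0 * Q i i by rewrite /qhat divfK // gt_eqF.
  have := wstar_ge Q0 (@size_vec_nonneg R k n); rewrite -qhN qhE -{2}(powR1_N N1) -powRD1 //.
  have k0 : 0 < k%:R :> R by apply: lt_le_trans k1.
  rewrite -ler_pdivrMl //; apply: le_trans.
  apply: (ge_powRM N1 (x := - tau) _ (lexx _)); first by apply: ge_powRV.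
  by case/andP: d2P => *; lra.
have ws0 : 0 < h * wstar nv Q.
  by rewrite mulr_gt0 //; apply: lt_le_trans ws_ge; apply: powR_gt0.
have c8 : 8 / h <= (Num.truncn (8 / h)).+1%:R by rewrite ltW // truncnS_gt.
have cK : (Num.truncn (8 / h)).+1%:R <= h / 10 * K by rewrite /K [leRHS]mulrC divfK // gt_eqF.
pose q := qstar Q; pose lam := (1 - h) * ln (q * N).
pose W0 := N `^ (1 - sigma - h / 20); pose b0 := W0 / (2 * lam).
pose theta := N `^ (- (h / 20)); pose m := Num.truncn (theta * b0).
pose t := Num.truncn (h / 10 * ln N / q).
have th01 : 0 < theta <= 1 by rewrite (theta_gt0 N1 erefl) (theta_le1 N1 exps erefl).
have lam0 : 0 < lam := lam_gt0 N1 L1 exps qE d1P erefl.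
have t0 : (0 < t)%N by rewrite -(ltr0n R) (block_set_size_gt0 N1 L1 exps qE k1 K1 kq erefl).
apply: le_trans (union_bound_le N1 exps Ctau kt).
apply: (pr_chromatic_number_wstar (rho := h / 10) (K := K) (kap := theta) (theta := theta) (lam := lam) (W0 := W0)
   (e := h * wstar nv Q) (a := W0) (q := q) (m := m) (t := t) P_sym P_itv lam0 _ ws0 h10 K1 _ th01
   _ _ cK t0 _ _ Qq (small_sum_le_half N1 exps Ctau) (large_sum_le_half N1 exps Ctau) (small_sum_le_half N1 exps Ctau)).
- exact: powR_gt0.
- by case/andP: th01.
- exact: (group_size_gt0 N1 L1 Ltau exps Ctau qE d1P erefl erefl erefl erefl erefl).
- exact: (group_size_le N1 L1 Ltau exps Ctau qE d1P erefl erefl erefl erefl erefl).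
- exact: (W0_ge2 N1 exps Ctau erefl).
- exact: powR_gt0.
- exact: (piece_small_sum_le N1 L1 Ltau exps Ctau qE d1P erefl erefl erefl erefl erefl).
- exact: (piece_large_sum_le N1 L1 Ltau exps Ctau qE d1P erefl erefl erefl erefl erefl).
- exact: (block_sum_le N1 L1 Ltau exps Ctau qE d1P erefl k1 K1 kq erefl).
- exact: (piece_sums_le_d N1 exps Ctau c8).
- exact: (block_sums_le_d N1 exps Ctau).
- exact: N1.
- exact: (total_colors_le N1 L1 Ltau exps Ctau qE d1P erefl erefl erefl erefl k1 kt K1 kq erefl ws_ge heps).
Qed.

(** * From a fixed loss to o(1), uniformly over the instances *)

Lemma diagonal_eventually (F : nat -> nat -> Prop) :
  (forall j, \forall m \near \oo, F j m) ->
  exists2 J : nat -> nat, (forall j, \forall m \near \oo, (j <= J m)%N) &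
    \forall m \near \oo, F (J m) m.
Proof.
move=> hF.
have /choice[M hM] : forall j, exists M : nat, forall m, (M <= m)%N -> F j m.
  by move=> j; have [M _ hM] := hF j; exists M => m Mm; apply: hM.
(* The largest index up to [m] whose threshold is passed; from [M 0] on the range is nonempty and
   the maximum is attained, before that it defaults to 0. *)
pose J m := (\max_(j < m.+1 | (M j <= m)%N) j)%N.
exists J => [j|].
  exists (maxn j (M j)) => // m /=; rewrite geq_max => /andP[jm Mm].
  have jm' : (j < m.+1)%N by [].
  exact: (@leq_bigmax_cond _ (fun j : 'I_m.+1 => (M j <= m)%N) (fun j : 'I_m.+1 => nat_of_ord j) (Ordinal jm')).
exists (M 0%N) => // m /= Mm; apply: hM.
have [|j jM jE] := @eq_bigmax_cond _ (fun j : 'I_m.+1 => (M j <= m)%N) (fun j : 'I_m.+1 => nat_of_ord j).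
  by apply/card_gt0P; exists ord0.
by rewrite (_ : J m = j); [exact: jM | exact: jE].
Qed.

(** The inequality 1 + x <= e^x bounds p = N^(tau / 2) below by (tau / 2) ln N; one more factor p,
    eventually at least 2 / tau, removes the constant. *)
Lemma eventually_powR_ge (R : realType) (tau c : R) : 0 < tau ->
  exists2 N0, 1 <= N0 & forall N, N0 <= N -> c <= N `^ tau /\ ln N <= N `^ tau.
Proof.
move=> tau0; pose y := Num.max (Num.max c (2 / tau)) 0.
exists (expR (y * (2 / tau))) => [|N hN].
  by rewrite -expR0 ler_expR mulr_ge0 ?divr_ge0 ?(ltW tau0) // le_max lexx orbT.
have N0 : 0 < N by apply: lt_le_trans hN; apply: expR_gt0.
have yL : y <= tau / 2 * ln N.
  have : y * (2 / tau) <= ln N by rewrite -[leLHS]expRK ler_ln ?posrE ?expR_gt0.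
  rewrite mulrA ler_pdivrMr // => h; lra.
have y0 : 0 <= y by rewrite le_max lexx orbT.
have yc : c <= y by rewrite !le_max lexx.
have yt : 2 / tau <= y by rewrite !le_max lexx orbT.
have half : 1 + tau / 2 * ln N <= N `^ (tau / 2).
  by rewrite /powR gt_eqF //; apply: expR_ge1Dx.
have NE : N `^ tau = N `^ (tau / 2) * N `^ (tau / 2).
  rewrite -powRD; first by congr (_ `^ _); lra.
  by apply/implyP => _; rewrite gt_eqF.
set p := N `^ (tau / 2) in half NE; have p1 : 1 <= p by lra.
have pp : p <= p * p by rewrite ler_peMl // (le_trans ler01).
rewrite NE; split; first by lra.
have tl : tau / 2 * ln N <= p by lra.
have : 2 / tau * (tau / 2 * ln N) <= p * p by apply: ler_pM => //; rewrite ?divr_ge0 ?(ltW tau0) //; lra.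
apply: le_trans.
have -> : 2 / tau * (tau / 2 * ln N) = tau^-1 * tau * ln N by lra.
by rewrite mulVf ?gt_eqF // mul1r.
Qed.

Unset Implicit Arguments.

(** The sequence [delta] must not depend on the instance. For each fixed loss [hj j] the bound holds
    for all instances from some [m] on, and [delta m] is -2 times the loss with the diagonal
    index. *)
Theorem theorem2p5 (R : realType) (sigma0 eps : R)
    (hsigma0 : 0 < sigma0 < 1 / 4) (heps : 0 < eps)
    (* rates of convergence in the hypotheses, indexed by m -> oo *)
    (N rk rqs rqh rw : nat -> R)
    (hN : N m @[m --> \oo] --> +oo)
    (hrk : rk m @[m --> \oo] --> (0 : R))
    (hrqs : rqs m @[m --> \oo] --> (0 : R))
    (hrqh : rqh m @[m --> \oo] --> (0 : R))
    (hrw : rw m @[m --> \oo] --> (0 : R)) :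
  exists2 delta : nat -> R,
    delta m @[m --> \oo] --> (0 : R) &
    \forall m \near \oo,
      forall (k : nat) (n : 'I_k -> nat) (P : 'M[R]_k) (sigma : R),
        let nv := size_vec R n in
        let Q := logQ P in
        (forall i, (0 < n i)%N) ->
        (forall i j, P i j = P j i) ->
        (forall i j, 0 <= P i j < 1) ->
        0 <= sigma <= sigma0 ->
        N m <= norm1 nv ->
        pow_within (k%:R) (norm1 nv) 0 (rk m) ->
        pow_within (qstar Q) (norm1 nv) (- sigma) (rqs m) ->
        pow_within (qhat nv Q) (norm1 nv) (- sigma) (rqh m) ->
        k%:R * qhat nv Q * qstar Q * (norm1 nv / ln (norm1 nv))
          <= rw m * wstar nv Q ->
        sbm_Pr P (fun G : sgraph (sbm_vertex n) =>
            (1 + eps) * (wstar nv Q / (2 * ln (qstar Q * norm1 nv)))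
              < (chromatic_number G)%:R)
          <= expR (- (norm1 nv `^ (2 - 4 * sigma + delta m))).
Proof.
have /andP[sg0 sg1] := hsigma0.
(* The three bounds serve the numerical estimates, the number of colours (8 h <= eps) and the union
   bound (4 sigma + 2 h <= 1); the last is where sigma0 < 1 / 4 enters. *)
pose h0 := Num.min (1 / 10) (Num.min (eps / 8) ((1 - 4 * sigma0) / 2)).
have h00 : 0 < h0.
  rewrite !lt_min; apply/and3P; split; first by lra.
    by rewrite divr_gt0.
  by rewrite divr_gt0 // subr_gt0; lra.
have [h01 h02 h03] : [/\ h0 <= 1 / 10, h0 <= eps / 8 & h0 <= (1 - 4 * sigma0) / 2].
  by split; rewrite !ge_min lexx ?orbT.
pose hj j := h0 / j.+1%:R : R.
have hj0 j : 0 < hj j by rewrite divr_gt0.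
have hjle j : hj j <= h0 by rewrite ler_pdivrMr // ler_peMr ?(ltW h00) // ler1n.
pose F j m := forall (k : nat) (n : 'I_k -> nat) (P : 'M[R]_k) (sigma : R),
        let nv := size_vec R n in
        let Q := logQ P in
        (forall i, (0 < n i)%N) ->
        (forall i j, P i j = P j i) ->
        (forall i j, 0 <= P i j < 1) ->
        0 <= sigma <= sigma0 ->
        N m <= norm1 nv ->
        pow_within (k%:R) (norm1 nv) 0 (rk m) ->
        pow_within (qstar Q) (norm1 nv) (- sigma) (rqs m) ->
        pow_within (qhat nv Q) (norm1 nv) (- sigma) (rqh m) ->
        k%:R * qhat nv Q * qstar Q * (norm1 nv / ln (norm1 nv))
          <= rw m * wstar nv Q ->
        sbm_Pr P (fun G : sgraph (sbm_vertex n) =>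
            (1 + eps) * (wstar nv Q / (2 * ln (qstar Q * norm1 nv)))
              < (chromatic_number G)%:R)
          <= expR (- (norm1 nv `^ (2 - 4 * sigma - 2 * hj j))).
have [|J Joo FJ] := @diagonal_eventually F; last first.
  exists (fun m => - (2 * hj (J m))).
    rewrite -oppr0; apply: cvgN; rewrite -(mulr0 2); apply: cvgMl_tmp.
    apply/cvgrPdist_le => /= e e0.
    have := Joo (Num.truncn (h0 / e)); apply: filterS => m hm.
    rewrite sub0r normrN ger0_norm ?(ltW (hj0 _)) // ler_pdivrMr // mulrC -ler_pdivrMr //.
    by apply: ltW; apply: lt_le_trans (truncnS_gt _) _; rewrite ler_nat ltnS.
  apply: filterS FJ => m Fm k n P sigma nv Q *.
  exact: Fm.
move=> j; set h := hj j; have h_gt0 : 0 < h := hj0 j; have hle : h <= h0 := hjle j.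
pose tau := h / 20 / 10; have tau0 : 0 < tau by rewrite !divr_gt0.
have [N0 N01 N0P] := eventually_powR_ge (20 * expR 1 / h) tau0.
pose K := (Num.truncn (8 / h)).+1%:R / (h / 10).
have K0 : 0 < K by rewrite !divr_gt0.
(* Chosen so that [rw m <= c0] gives the bound on k q* K that makes the dropped coordinates
   cheap. *)
pose c0 := h * (h / 10) / (2 * K).
have h10 : 0 < h / 10 by rewrite divr_gt0.
have c00 : 0 < c0 by apply: divr_gt0; apply: mulr_gt0.
have small (u : nat -> R) (e : R) : u m @[m --> \oo] --> (0 : R) -> 0 < e ->
    \forall m \near \oo, `|u m| <= e.
  move=> /cvgrPdist_le /= cu e0; have := cu e e0.
  by apply: filterS => m; rewrite sub0r normrN.
have /cvgryPge hN_ge := hN.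
near=> m.
move=> k n P sigma nv Q n_gt0 P_sym P_itv /andP[s0 ss0] Nm [d3 d3r kE] [d1 d1r qE] [d2 d2r qhE] hw.
set NN := norm1 nv in Nm kE qE qhE hw *.
have NmN0 : Num.max N0 (expR 1) <= N m by near: m; exact: hN_ge.
have {NmN0 Nm} : Num.max N0 (expR 1) <= NN by apply: le_trans Nm.
rewrite ge_max => /andP[NN0 NNe].
have [Ctau Ltau] := N0P NN NN0.
have N1 : 1 <= NN by apply: le_trans NN0.
have NNgt0 : 0 < NN by apply: lt_le_trans N1.
have L1 : 1 <= ln NN by rewrite -[leLHS]expRK ler_ln ?posrE ?expR_gt0.
have d1t : - tau <= d1 <= tau.
  by rewrite -ler_norml; apply: le_trans d1r _; apply: le_trans (ler_norm _) _; near: m; apply: small.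
have d2t : - tau <= d2 <= tau.
  by rewrite -ler_norml; apply: le_trans d2r _; apply: le_trans (ler_norm _) _; near: m; apply: small.
have d3t : - tau <= d3 <= tau.
  by rewrite -ler_norml; apply: le_trans d3r _; apply: le_trans (ler_norm _) _; near: m; apply: small.
have rwc : rw m <= c0.
  by apply: le_trans (ler_norm _) _; near: m; apply: small.
have Q0 a b : 0 <= Q a b by apply: logQ_ge0.
have qh0 : 0 < qhat nv Q * NN by rewrite qhE mulr_gt0 // powR_gt0.
have ws0 : 0 <= wstar nv Q.
  have k0 : 0 < k%:R :> R by rewrite kE powR_gt0.
  have := wstar_ge Q0 (@size_vec_nonneg R k n).
  have -> : \sum_i size_vec R n i 0 * Q i i = qhat nv Q * NN by rewrite /qhat divfK // gt_eqF.
  by move=> /(lt_le_trans qh0); rewrite pmulr_rgt0 // => /ltW.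
have wsle : wstar nv Q <= qhat nv Q * NN.
  have := wstar_le Q0 (@size_vec_nonneg R k n).
  by rewrite (_ : \sum_i _ = qhat nv Q * NN) // /qhat divfK // gt_eqF.
have L0 : 0 < ln NN by apply: lt_le_trans L1.
(* Replacing w_* by its upper bound qhat N in the hypothesis lets the positive factor qhat N
   cancel. *)
have kq : k%:R * qstar Q <= c0 * ln NN.
  rewrite -ler_pdivrMr // -(ler_pM2r qh0).
  have -> : k%:R * qstar Q / ln NN * (qhat nv Q * NN) =
    k%:R * qhat nv Q * qstar Q * (NN / ln NN) by lra.
  apply: le_trans hw _; apply: (@le_trans _ _ (c0 * wstar nv Q)); first exact: ler_wpM2r.
  by rewrite ler_wpM2l // ltW.
apply: (pr_chromatic_number_powers (h := h) (tau := tau) (d1 := d1) (d2 := d2) (d3 := d3)) => //.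
- by split; rewrite /tau; lra.
- lra.
- by rewrite kE add0r.
- have K2 : 0 < 2 * K by rewrite mulr_gt0.
  rewrite -/K -(ler_pdivlMr _ _ K2); apply: le_trans kq _; rewrite /c0; lra.
Unshelve. all: by end_near.
Qed.
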